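(* Let $A$ be a Buchsbaum local ring with maximal ideal $\mathfrak{m}$ and assume that $\dim A \geq 2$, or that $\dim A = 1$ and $\mathrm{e}(A) > 1$. Then there exists an integer $\ell \gg 0$ such that $I^2 = QI$ for every parameter ideal $Q \subseteq \mathfrak{m}^{\ell}$, where $I = Q : \mathfrak{m}$.
   Context: A parameter ideal in $A$ is an ideal generated by a system of parameters. A Noetherian local ring $A$ with maximal ideal $\mathfrak{m}$ and $d = \dim A\geq 1$ is a Buchsbaum ring if the difference $\ell_A(A/Q) - \mathrm{e}^0_Q(A)$ is independent of the choice of a parameter ideal $Q$, where $\mathrm{e}^0_Q(A)$ is the multiplicity of $A$ with respect to $Q$ and $\ell_A$ denotes length; equivalently, every system of parameters $x_1,\dots,x_d$ satisfies $(x_1,\dots,x_{i-1}):x_i = (x_1,\dots,x_{i-1}):\mathfrak{m}$ for all $1\leq i\leq d$. $\mathrm{e}(A) = \mathrm{e}^0_{\mathfrak{m}}(A)$ is the multiplicity of $A$ with respect to $\mathfrak{m}$; $Q:\mathfrak{m} = \{x\in A \mid x\mathfrak{m}\subseteq Q\}$. *)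

(* Defs.v *)
From mathcomp Require Import all_boot all_order all_algebra.
From mathcomp Require Import boolp classical_sets.

Set Implicit Arguments.
Unset Strict Implicit.
Unset Printing Implicit Defensive.

Import GRing.Theory.
Local Open Scope classical_set_scope.
Local Open Scope ring_scope.

Section Chains.
Variable T : Type.
Implicit Types (C : set (set T)) (n : nat).

(* A strict chain P 0 < ... < P n, of length n, of members of C. *)
Definition has_chain C n : Prop :=
  exists P : nat -> set T,
    (forall i, (i <= n)%N -> C (P i)) /\
    (forall i, (i < n)%N -> P i `<` P i.+1).

(* Supremum of the lengths of strict chains in C; by convention 0 when C is
   empty or these lengths are unbounded. *)
Definition chain_sup C : nat :=
  xget 0%N [set n | has_chain C n /\ forall k, has_chain C k -> (k <= n)%N].

End Chains.

Section CommutativeAlgebra.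
Variable A : comNzRingType.
Implicit Types (I J Q P M m : set A) (s : seq A) (n : nat).

(* Ideals are not required to be proper. *)
Definition is_ideal I : Prop :=
  [/\ I 0, (forall x y, I x -> I y -> I (x + y)) &
      (forall a x, I x -> I (a * x))].

Definition prime_ideal P : Prop :=
  [/\ is_ideal P, ~ P 1 & forall x y, P (x * y) -> P x \/ P y].

Definition maximal_ideal M : Prop :=
  [/\ is_ideal M, ~ M 1 &
      forall J, is_ideal J -> M `<=` J -> J = M \/ J = setT].

Definition ideal_gen (S : set A) : set A := smallest is_ideal S.

Definition ideal_mul I J : set A :=
  ideal_gen [set z | exists x y, [/\ I x, J y & z = x * y]].

Definition ideal_exp I n : set A := iterop n ideal_mul I setT.

Definition ideal_colon I J : set A := [set x | forall y, J y -> I (x * y)].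

Definition radical I : set A := [set x | exists n, I (x ^+ n)].

Definition noetherian : Prop :=
  forall I, is_ideal I -> exists s, I = ideal_gen [set` s].

Definition local_ring m : Prop := forall M, maximal_ideal M <-> M = m.

Definition krull_dim : nat := chain_sup prime_ideal.

(* The length of the A-module A/I: its submodules are the J/I with J an ideal
   containing I. *)
Definition colength I : nat := chain_sup [set J | is_ideal J /\ I `<=` J].

(* The polynomial giving the length of A/Q^(n+1) for all large n, which exists
   and has degree dim A when Q is primary to the maximal ideal of a Noetherian
   local ring. *)
Definition hilbert_samuel_poly Q : {poly rat} :=
  xget 0 [set p | exists N, forall n, (N <= n)%N ->
                    p.[n%:R] = (colength (ideal_exp Q n.+1))%:R].

Definition multiplicity Q : rat :=
  krull_dim`!%:R * (hilbert_samuel_poly Q)`_krull_dim.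

(* m is the maximal ideal of the local ring A: the parameters generate an ideal
   that is primary to m. *)
Definition system_of_parameters m s : Prop :=
  size s = krull_dim /\ radical (ideal_gen [set` s]) = m.

Definition parameter_ideal m Q : Prop :=
  exists2 s, system_of_parameters m s & Q = ideal_gen [set` s].

Definition buchsbaum m : Prop :=
  [/\ noetherian, local_ring m, (1 <= krull_dim)%N &
      forall Q Q', parameter_ideal m Q -> parameter_ideal m Q' ->
        (colength Q)%:R - multiplicity Q = (colength Q')%:R - multiplicity Q'].

End CommutativeAlgebra.

Arguments krull_dim A : clear implicits.
Arguments noetherian A : clear implicits.

(* Main.v *)
Require Import Defs.
From mathcomp Require Import all_boot all_order all_algebra.
From mathcomp Require Import boolp classical_sets.
From mathcomp Require Import ring zify.

Set Implicit Arguments.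
Unset Strict Implicit.
Unset Printing Implicit Defensive.

Import Order.TTheory GRing.Theory Num.Theory.
Local Open Scope classical_set_scope.
Local Open Scope ring_scope.

(* The constancy of l(A/Q) - e(Q) under powers of parameters forces e(Q) to be linear in each
   exponent, hence makes l(A/(x_1, ..., x_i^a, ..., x_d)) affine in a; this yields the colon property
   (x_j, j in S) : x_i = (x_j, j in S) : m for all subsets S of a system of parameters and i not in S.

   Let L(Q) = Q + sum_i ((q_j, j <> i) : m) be the limit closure of Q; it is contained in Q : m.
   Multiplication by the determinant of q = M t induces an injection A/L(t) -> A/L(q), so these
   quotients embed in the top local cohomology module. The socle of that module comes from a fixed
   system t^(d+1), and therefore L(Q) : m is contained in Q : m as soon as Q is contained in
   (t_1^(d+2), ..., t_d^(d+2)).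

   Put I = Q : m. Then mI is contained in mQ: otherwise m^2 = zm for some z in m, so d = 1 by Krull's
   principal ideal theorem, and moreover e(A) = 1. For x, y in I write xy = sum a_i q_i and, for z
   in m, yz = sum b_i q_i with b_i in m. From sum_i (a_i z - x b_i) q_i = 0 and x b_i in Q one gets
   a_i z in L(Q), so a_i is in L(Q) : m, hence in I, and xy is in QI. *)

(** * Ideals of a Noetherian local ring *)

Section Ideals.
Variable A : comNzRingType.
Implicit Types (I J K N : set A) (x y z u : A).

(** Linearity in one exponent is asymptotic. Raising all d parameters to the power k multiplies e by
    exactly k^d, while raising a single one to the power n multiplies a colength by at most n; the
    constant l - e becomes negligible as k grows, and two opposite inequalities remain.

    Local cohomology enters through its finite levels A/L(t^n), whose transition maps,
    multiplication by powers of t_1...t_d, are injective. A socle element descends to level d+1: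
    each of the d coordinates costs one factor t_1...t_d, and one more is spent in passing from
    L(t^n) to (t^(n+1)). The last unit in d+2 is there because t_1...t_d carries L(t^(d+1)) into the
    ideal (t^(d+2)) itself, so that m multiplies the lifted element into Q and not merely into L(Q).
    As t is chosen once and for all, the bound on Q is uniform.

    For d >= 2, taking Q inside m^3 gives m^2 inside zm + m^3, which Nakayama turns into m^2 inside
    zm.

    Colength, multiplicity and dimension fall back on default values, so finiteness of lengths and
    existence of Hilbert-Samuel polynomials have to be established. *)

Lemma idl0 I : is_ideal I -> I 0.
Proof. by case. Qed.

Lemma idlD I x y : is_ideal I -> I x -> I y -> I (x + y).
Proof. by case=> _ + _; apply. Qed.

Lemma idlMl I x y : is_ideal I -> I y -> I (x * y).
Proof. by case=> _ _; apply. Qed.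

Lemma idlMr I x y : is_ideal I -> I x -> I (x * y).
Proof. by rewrite mulrC; apply: idlMl. Qed.

Lemma idlN I x : is_ideal I -> I x -> I (- x).
Proof. by rewrite -mulN1r; apply: idlMl. Qed.

Lemma idlB I x y : is_ideal I -> I x -> I y -> I (x - y).
Proof. by move=> iI Ix Iy; apply: idlD => //; apply: idlN. Qed.

Lemma idlBC I x y : is_ideal I -> I (x - y) -> I (y - x).
Proof. by move=> iI /(idlN iI); rewrite opprB. Qed.

Lemma idlBr I x y : is_ideal I -> I (x - y) -> I y -> I x.
Proof. by move=> iI Ixy /(idlD iI Ixy); rewrite subrK. Qed.

Lemma idlBl I x y : is_ideal I -> I (x - y) -> I x -> I y.
Proof. by move=> iI /(idlBC iI); apply: idlBr. Qed.

Lemma idl_sum I (T : Type) (r : seq T) (P : pred T) (F : T -> A) :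
  is_ideal I -> (forall i, P i -> I (F i)) -> I (\sum_(i <- r | P i) F i).
Proof.
move=> iI IF; elim/big_rec: _ => [|i u Pi Iu]; first exact: idl0.
exact: idlD (IF i Pi) Iu.
Qed.

Lemma idlXn I x n k : is_ideal I -> (n <= k)%N -> I (x ^+ n) -> I (x ^+ k).
Proof. by move=> iI /subnK <-; rewrite exprD; apply: idlMl. Qed.

Lemma is_idealT : is_ideal (setT : set A).
Proof. by []. Qed.

Lemma idlT I : is_ideal I -> I 1 -> I = setT.
Proof.
by move=> iI I1; apply/seteqP; split=> // x _; rewrite -(mulr1 x); apply: idlMl.
Qed.

Lemma is_ideal_gen (S : set A) : is_ideal (ideal_gen S).
Proof.
split=> [J [[]]//|x y gx gy J [iJ SJ]|a x gx J [iJ SJ]].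
  by apply: idlD => //; [apply: gx|apply: gy].
by apply: idlMl => //; apply: gx.
Qed.

Lemma ideal_gen_sub (S : set A) I : is_ideal I -> S `<=` I -> ideal_gen S `<=` I.
Proof. by move=> iI SI; apply: smallest_sub. Qed.

Lemma ideal_genP (S : set A) x : S x -> ideal_gen S x.
Proof. by apply: sub_gen_smallest. Qed.

Lemma is_ideal_mul I J : is_ideal (ideal_mul I J).
Proof. exact: is_ideal_gen. Qed.

Lemma ideal_mulP I J x y : I x -> J y -> ideal_mul I J (x * y).
Proof. by move=> Ix Jy; apply: ideal_genP; exists x, y. Qed.

Lemma ideal_mul_sub I J K : is_ideal K ->
  (forall x y, I x -> J y -> K (x * y)) -> ideal_mul I J `<=` K.
Proof. by move=> iK IJK; apply: ideal_gen_sub => // _ [x [y [? ? ->]]]; apply: IJK. Qed.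

Lemma ideal_mulS I I' J J' : I `<=` I' -> J `<=` J' -> ideal_mul I J `<=` ideal_mul I' J'.
Proof.
move=> II' JJ'; apply: ideal_mul_sub => [|x y Ix Jy]; first exact: is_ideal_mul.
by apply: ideal_mulP; [apply: II'|apply: JJ'].
Qed.

Lemma ideal_mul_subr I J : is_ideal J -> ideal_mul I J `<=` J.
Proof. by move=> iJ; apply: ideal_mul_sub => // x y _; apply: idlMl. Qed.

Lemma ideal_mul_subl I J : is_ideal I -> ideal_mul I J `<=` I.
Proof. by move=> iJ; apply: ideal_mul_sub => // x y + _; apply: idlMr. Qed.

Lemma is_ideal_exp I n : is_ideal I -> is_ideal (ideal_exp I n).
Proof. by move=> iI; case: n => [|[|n]] //; apply: is_ideal_mul. Qed.

Lemma ideal_expS I n : is_ideal I -> ideal_exp I n.+1 = ideal_mul I (ideal_exp I n).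
Proof.
move=> iI; case: n => [|n] //.
apply/seteqP; split; last exact: ideal_mul_subl.
by move=> x Ix; rewrite -(mulr1 x); apply: ideal_mulP.
Qed.

Lemma ideal_expSl I n : is_ideal I -> ideal_exp I n.+1 `<=` ideal_exp I n.
Proof. by move=> iI; rewrite ideal_expS //; apply: ideal_mul_subr; apply: is_ideal_exp. Qed.

Lemma ideal_exp_le I n k : is_ideal I -> (n <= k)%N -> ideal_exp I k `<=` ideal_exp I n.
Proof.
move=> iI; elim: k => [|k IHk]; first by rewrite leqn0 => /eqP->.
rewrite leq_eqVlt => /predU1P[-> //|/IHk]; apply: subset_trans; exact: ideal_expSl.
Qed.

Lemma ideal_expS_le I J n : is_ideal I -> is_ideal J -> I `<=` J ->
  ideal_exp I n `<=` ideal_exp J n.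
Proof.
by move=> iI iJ IJ; elim: n => [|n IH] //; rewrite !ideal_expS //; apply: ideal_mulS.
Qed.

Definition icolp I y : set A := [set a | I (a * y)].

Lemma is_ideal_colp I y : is_ideal I -> is_ideal (icolp I y).
Proof.
move=> iI; split=> [|u v|a u]; rewrite /icolp /= ?mul0r ?mulrDl -?mulrA.
- exact: idl0.
- exact: idlD.
- exact: idlMl.
Qed.

Lemma ideal_expD I n k x y : is_ideal I ->
  ideal_exp I n x -> ideal_exp I k y -> ideal_exp I (n + k) (x * y).
Proof.
move=> iI; elim: n x => [|n IH] x.
  by move=> _ ky; apply: idlMl => //; apply: is_ideal_exp.
rewrite addSn !ideal_expS // => nx ky.
suff: ideal_mul I (ideal_exp I n) `<=` icolp (ideal_mul I (ideal_exp I (n + k))) y.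
  exact.
apply: ideal_mul_sub; first by apply: is_ideal_colp; apply: is_ideal_mul.
by move=> u v Iu nv; rewrite /icolp /= -mulrA; apply: ideal_mulP => //; apply: IH.
Qed.

Lemma ideal_expX I x n : is_ideal I -> I x -> ideal_exp I n (x ^+ n).
Proof.
move=> iI Ix; elim: n => [|n IH] //; rewrite ideal_expS // exprS; exact: ideal_mulP.
Qed.

Lemma is_ideal_colon I J : is_ideal I -> is_ideal (ideal_colon I J).
Proof.
move=> iI; split=> [|x y Ix Iy|a x Ix] z Jz; rewrite ?mul0r ?mulrDl -?mulrA.
- exact: idl0.
- exact: (idlD iI (Ix _ Jz) (Iy _ Jz)).
- exact: (idlMl _ iI (Ix _ Jz)).
Qed.

Lemma ideal_colon_sub I J : is_ideal I -> I `<=` ideal_colon I J.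
Proof. by move=> iI x Ix y _; apply: idlMr. Qed.

Definition iaddp I y : set A := [set z | exists a, I (z - a * y)].

Lemma is_ideal_addp I y : is_ideal I -> is_ideal (iaddp I y).
Proof.
move=> iI; split=> [|u v [a Ia] [b Ib]|a u [b Ib]].
- by exists 0; rewrite mul0r subr0; apply: idl0.
- exists (a + b); have -> : u + v - (a + b) * y = (u - a * y) + (v - b * y) by ring.
  exact: idlD.
- exists (a * b); have -> : a * u - a * b * y = a * (u - b * y) by ring.
  exact: idlMl.
Qed.

Lemma sub_addp I y : I `<=` iaddp I y.
Proof. by move=> x Ix; exists 0; rewrite mul0r subr0. Qed.

Lemma mem_addp I y : is_ideal I -> iaddp I y y.
Proof. by move=> iI; exists 1; rewrite mul1r subrr; apply: idl0. Qed.

Lemma addp_sub I y K : is_ideal K -> I `<=` K -> K y -> iaddp I y `<=` K.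
Proof.
by move=> iK IK Ky z [a /IK Kz]; apply: (idlBr iK Kz); apply: idlMl.
Qed.

Lemma addpS I J y : I `<=` J -> iaddp I y `<=` iaddp J y.
Proof. by move=> IJ z [a /IJ Jz]; exists a. Qed.

Lemma sub_colp I y : is_ideal I -> I `<=` icolp I y.
Proof. by move=> iI u Iu; apply: idlMr. Qed.

Lemma colpS I J y : I `<=` J -> icolp I y `<=` icolp J y.
Proof. by move=> IJ z /IJ. Qed.

Lemma is_ideal_prin y : is_ideal [set z | exists a, z = a * y].
Proof.
split=> [|_ _ [a ->] [b ->]|a _ [b ->]].
- by exists 0; rewrite mul0r.
- by exists (a + b); rewrite mulrDl.
- by exists (a * b); rewrite mulrA.
Qed.

Definition iadd I J : set A := [set z | exists2 w, J w & I (z - w)].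

Lemma is_ideal_add I J : is_ideal I -> is_ideal J -> is_ideal (iadd I J).
Proof.
move=> iI iJ; split=> [|u v [a Ja Ia] [b Jb Ib]|a u [b Jb Ib]].
- by exists 0; rewrite ?subr0; apply: idl0.
- by exists (a + b); [exact: idlD|rewrite opprD addrACA; exact: idlD].
- by exists (a * b); [exact: idlMl|rewrite -mulrBr; exact: idlMl].
Qed.

Lemma iadd_subr I J : is_ideal I -> J `<=` iadd I J.
Proof. by move=> iI x Jx; exists x; rewrite ?subrr //; apply: idl0. Qed.

Lemma iadd_subl I J : is_ideal J -> I `<=` iadd I J.
Proof. by move=> iJ x Ix; exists 0; rewrite ?subr0 //; apply: idl0. Qed.

Hypothesis noeth : noetherian A.

Lemma noetherian_max (F : set (set A)) :
  (forall I, F I -> is_ideal I) -> (exists I, F I) ->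
  exists2 I, F I & forall J, F J -> I `<=` J -> J = I.
Proof.
move=> Fid [I0 FI0].
have [|M [PM maxM]] := @Zorn_bigcup A [set X | X = set0 \/ F X].
  move=> G GF Gtot.
  have [[X0 GX0 FX0]|noF] := pselect (exists2 X, G X & F X); last first.
    left; apply/seteqP; split=> // z [X GX Xz].
    by case: (GF X GX) => [X0|FX]; [rewrite X0 in Xz|apply: noF; exists X].
  have iU : is_ideal (\bigcup_(X in G) X).
    split.
    - by exists X0 => //; apply: idl0; apply: Fid.
    - move=> u v [X GX Xu] [Y GY Yv].
      have FX : F X by case: (GF X GX) => // X00; rewrite X00 in Xu.
      have FY : F Y by case: (GF Y GY) => // X00; rewrite X00 in Yv.
      case: (Gtot X Y GX GY) => [XY|YX].
        by exists Y => //; apply: (idlD (Fid _ FY)) => //; apply: XY.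
      by exists X => //; apply: (idlD (Fid _ FX)) => //; apply: YX.
    - move=> a u [X GX Xu].
      have FX : F X by case: (GF X GX) => // X00; rewrite X00 in Xu.
      by exists X => //; apply: (idlMl _ (Fid _ FX)).
  have [s Us] := noeth iU.
  have [X GX [FX sX]] : exists2 X, G X & F X /\ {subset s <= [pred z | `[< X z >]]}.
    have : {in s, forall z, (\bigcup_(X in G) X) z}.
      by move=> z zs; rewrite Us; apply: ideal_genP.
    elim: s {Us} => [|a s IH] sU; first by exists X0.
    have [|X GX [FX sX]] := IH; first by move=> z zs; apply: sU; rewrite inE zs orbT.
    have [Y GY Ya] := sU a (mem_head _ _).
    have FY : F Y by case: (GF Y GY) => // X00; rewrite X00 in Ya.
    case: (Gtot X Y GX GY) => [XY|YX].
      exists Y => //; split=> // z; rewrite inE => /predU1P[->|/sX /asboolP Xz]; apply/asboolP => //.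
      exact: XY.
    exists X => //; split=> // z; rewrite inE => /predU1P[->|/sX //]; apply/asboolP.
    exact: YX.
  right; suff -> : \bigcup_(X in G) X = X by [].
  apply/seteqP; split=> [|z Xz]; last by exists X.
  by rewrite Us; apply: ideal_gen_sub; [apply: Fid|move=> z /= /sX /asboolP].
have FM : F M.
  case: PM => // M0; case: (maxM I0); last by right.
  rewrite M0; split=> // /(_ 0); apply.
  by apply: idl0; apply: Fid.
exists M => // J FJ MJ; apply: contrapT => JM; apply: (maxM J); last by right.
by split=> // JM'; apply: JM; apply/seteqP.
Qed.

Lemma noetherian_chain (I : nat -> set A) : (forall n, is_ideal (I n)) ->
  (forall n, I n `<=` I n.+1) -> exists n0, forall n, (n0 <= n)%N -> I n = I n0.
Proof.
move=> iI Inc.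
have mon n k : (n <= k)%N -> I n `<=` I k.
  move/subnK <-; elim: (k - n)%N => // j IH; exact: subset_trans IH (Inc _).
have [||_ [n0 _ <-] maxn0] := @noetherian_max [set I n | n in setT].
- by move=> _ [n _ <-].
- by exists (I 0%N), 0%N.
exists n0 => n n0n; apply: maxn0 (mon _ _ n0n); by exists n.
Qed.

Variable m : set A.
Hypothesis locm : local_ring m.

Lemma max_ideal_ax : maximal_ideal m.
Proof. exact/locm. Qed.

Lemma is_ideal_max : is_ideal m.
Proof. by case: max_ideal_ax. Qed.

Lemma max_n1 : ~ m 1.
Proof. by case: max_ideal_ax. Qed.

Lemma proper_sub_max I : is_ideal I -> ~ I 1 -> I `<=` m.
Proof.
move=> iI nI1.
have [||I' [iI' nI'1 II'] maxI'] := @noetherian_max [set J | [/\ is_ideal J, ~ J 1 & I `<=` J]].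
- by move=> J [].
- by exists I; split.
suff <- : I' = m by [].
apply/locm; split=> // J iJ I'J.
have [J1|nJ1] := pselect (J 1); first by right; apply: idlT.
by left; apply: maxI' => //; split=> //; apply: subset_trans I'J.
Qed.

Lemma unit_nmax x : ~ m x -> exists y, y * x = 1.
Proof.
move=> nmx; apply: contrapT => nx; apply: nmx.
apply: (proper_sub_max (is_ideal_prin x)); last by exists 1; rewrite mul1r.
by case=> y y1; apply: nx; exists y.
Qed.

Lemma unit_1B x : m x -> exists y, y * (1 - x) = 1.
Proof.
move=> mx; apply: unit_nmax => m1x; apply: max_n1.
by rewrite -(subrK x 1); apply: idlD => //; apply: is_ideal_max.
Qed.

Lemma colp_unit I x u : is_ideal I -> m x -> I ((1 - x) * u) -> I u.
Proof.
move=> iI /unit_1B[y y1] Iu; rewrite -(mul1r u) -y1 -mulrA.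
exact: idlMl.
Qed.

(** Let [K] be maximal among the ideals containing [J] but not [N], and [y] in [N] outside [K]. Then
    [N] lies in K + (y), so [y] lies in K + m y, and (1 - a) y is in [K] with 1 - a a unit. *)
Lemma nakayama N J : is_ideal N -> is_ideal J ->
  (forall u, N u -> exists2 w, ideal_mul m N w & J (u - w)) -> N `<=` J.
Proof.
move=> iN iJ NJ; apply: contrapT => nNJ.
have [||K [iK JK nNK] maxK] := @noetherian_max [set K | [/\ is_ideal K, J `<=` K & ~ N `<=` K]].
- by move=> K [].
- by exists J; split.
have [y Ny nKy] : exists2 y, N y & ~ K y.
  by apply: contrapT => h; apply: nNK => y Ny; apply: contrapT => nKy; apply: h; exists y.
have NKy : N `<=` iaddp K y.
  apply: contrapT => h; apply: nKy; rewrite -(maxK (iaddp K y)); first exact: mem_addp.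
    split=> //; first exact: is_ideal_addp.
    exact: subset_trans JK (@sub_addp _ _).
  exact: sub_addp.
have iE : is_ideal [set z | exists2 a, m a & K (z - a * y)].
  have im := is_ideal_max; split=> [|u v [a ma Ia] [b mb Ib]|a u [b mb Ib]].
  - by exists 0; rewrite ?mul0r ?subr0; apply: idl0.
  - exists (a + b); first exact: idlD.
    have -> : u + v - (a + b) * y = (u - a * y) + (v - b * y) by ring.
    exact: idlD.
  - exists (a * b); first exact: idlMl.
    have -> : a * u - a * b * y = a * (u - b * y) by ring.
    exact: idlMl.
have [w mNw /JK Kyw] := NJ y Ny.
have [|a ma Kwa] := (@ideal_mul_sub m N _ iE _ w mNw).
  move=> a u ma /NKy[b Kb]; exists (a * b); first by apply: idlMr => //; apply: is_ideal_max.
  have -> : a * u - a * b * y = a * (u - b * y) by ring.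
  exact: idlMl.
apply/nKy/(colp_unit iK ma).
have -> : (1 - a) * y = (y - w) + (w - a * y) by ring.
exact: idlD.
Qed.

Lemma nakayama1 N J x : is_ideal N -> is_ideal J -> m x ->
  (forall u, N u -> exists2 v, N v & J (u - x * v)) -> N `<=` J.
Proof.
move=> iN iJ mx NJ; apply: nakayama => // u /NJ[v Nv Juv].
by exists (x * v) => //; apply: ideal_mulP.
Qed.

(** Stabilisation of the chain c : r^n plays the part of Artin-Rees: if u = a r^(n0+1) modulo [c] is
    in the intersection, so is a r^n0. Hence the intersection lies in [c] plus [r] times itself. *)
Lemma krull_intersection1 (c : set A) r : is_ideal c -> m r ->
  [set u | forall n, iaddp c (r ^+ n) u] `<=` c.
Proof.
move=> ic mr.
have [n0 h0] : exists n0, forall n, (n0 <= n)%N -> icolp c (r ^+ n) = icolp c (r ^+ n0).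
  apply: (@noetherian_chain (fun n => icolp c (r ^+ n))) => [n|n u].
    exact: is_ideal_colp.
  by rewrite /icolp /= exprSr mulrA; apply: idlMr.
apply: (nakayama1 (x := r)) => //.
  split=> [n|u v cu cv n|a u cu n].
  - by apply: idl0; apply: is_ideal_addp.
  - by apply: idlD => //; apply: is_ideal_addp.
  - by apply: idlMl => //; apply: is_ideal_addp.
move=> u cu; have [a ca] := cu n0.+1.
exists (r ^+ n0 * a); last by rewrite mulrA -exprS mulrC.
move=> n; have [b cb] := cu (n0 + n).+1; exists (b * r ^+ n0).
have: icolp c (r ^+ n0.+1) (a - r ^+ n * b).
  rewrite /icolp /=.
  have -> : (a - r ^+ n * b) * r ^+ n0.+1 = u - b * r ^+ (n0 + n).+1 - (u - a * r ^+ n0.+1).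
    by rewrite !exprS exprD; ring.
  exact: idlB.
rewrite h0 // /icolp /=.
by have -> : r ^+ n0 * a - b * r ^+ n0 * r ^+ n = (a - r ^+ n * b) * r ^+ n0 by ring.
Qed.

End Ideals.

(** * Colength *)

Section Length.
Variable A : comNzRingType.
Implicit Types (I J K : set A) (x y z u : A).

Definition ideals_over I : set (set A) := [set J | is_ideal J /\ I `<=` J].

(** [colength] is 0 by convention when chain lengths are unbounded, so comparisons of colengths
    carry this condition. *)
Definition finite_colength I : Prop :=
  exists n, forall k, has_chain (ideals_over I) k -> (k <= n)%N.

Lemma colengthP I : is_ideal I -> finite_colength I ->
  has_chain (ideals_over I) (colength I) /\
  forall k, has_chain (ideals_over I) k -> (k <= colength I)%N.
Proof.
move=> iI [n maxn].
apply: (@xgetPex _ 0%N [set n | has_chain (ideals_over I) n /\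
  forall k, has_chain (ideals_over I) k -> (k <= n)%N]).
have [|k /asboolP hk|k /asboolP ck kmax] :=
    @ex_maxnP (fun k => `[< has_chain (ideals_over I) k >]) n.
- by exists 0%N; apply/asboolP; exists (fun=> I); split=> // i _; split.
- exact: maxn hk.
- by exists k; split=> // j hj; apply/kmax/asboolP.
Qed.

Lemma chain_measure I (f : set A -> nat) n :
  (forall J K, ideals_over I J -> ideals_over I K -> J `<` K -> (f K < f J)%N) ->
  (forall J, ideals_over I J -> (f J <= n)%N) ->
  forall k, has_chain (ideals_over I) k -> (k <= n)%N.
Proof.
move=> flt fle k [P [Pid Plt]].
suff h j : (j <= k)%N -> (f (P j) + j <= f (P 0))%N.
  have := h k (leqnn k); have := fle _ (Pid 0%N isT); lia.
elim: j => [|j IH] jk; first by rewrite addn0.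
have := flt _ _ (Pid j (ltnW jk)) (Pid _ jk) (Plt _ jk).
by have := IH (ltnW jk); lia.
Qed.

Lemma finite_colengthS I J : I `<=` J -> finite_colength I -> finite_colength J.
Proof.
move=> IJ [n maxn]; exists n => k [P [Pid Plt]]; apply: maxn; exists P; split=> // i /Pid[iP JP].
by split=> //; apply: subset_trans JP.
Qed.

Lemma colengthS I J : is_ideal I -> is_ideal J -> finite_colength I -> I `<=` J ->
  (colength J <= colength I)%N.
Proof.
move=> iI iJ fI IJ; have [_] := colengthP iI fI; apply.
have [[P [Pid Plt]] _] := colengthP iJ (finite_colengthS IJ fI).
by exists P; split=> // i /Pid[iP JP]; split=> //; apply: subset_trans JP.
Qed.

Lemma colength_lt I J : is_ideal I -> is_ideal J -> finite_colength I -> I `<` J ->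
  (colength J < colength I)%N.
Proof.
move=> iI iJ fI [IJ JI]; have [_] := colengthP iI fI; apply.
have [[P [Pid Plt]] _] := colengthP iJ (finite_colengthS IJ fI).
exists (fun i => if i is i'.+1 then P i' else I); split=> [[|i] ik|[|i] ik]; first by split.
- by have [iP JP] := Pid i ik; split=> //; apply: subset_trans JP.
- have [iP JP] := Pid 0%N isT; split; first exact: subset_trans JP.
  by move=> PI; apply: JI; apply: subset_trans PI.
- exact: Plt.
Qed.

Lemma colength_eq I J : is_ideal I -> is_ideal J -> finite_colength I -> I `<=` J ->
  colength J = colength I -> J = I.
Proof.
move=> iI iJ fI IJ cIJ; apply/seteqP; split=> //; apply: contrapT => JI.
by have := colength_lt iI iJ fI (conj IJ JI); rewrite cIJ ltnn.
Qed.

Lemma finite_colengthT : finite_colength (setT : set A).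
Proof.
exists 0%N => -[|k] // [P [Pid Plt]].
by have [_] := Plt 0%N isT; case; apply: subset_trans (Pid 0%N isT).2.
Qed.

Lemma colengthT : colength (setT : set A) = 0%N.
Proof.
have [[P [Pid Plt]] _] := colengthP (@is_idealT A) finite_colengthT.
case E : (colength _) => [|k] //; rewrite E in Pid Plt.
by have [_] := Plt 0%N isT; case; apply: subset_trans (Pid 0%N isT).2.
Qed.

Section Additivity.
Variables (I : set A) (y : A).
Hypotheses (iI : is_ideal I) (fa : finite_colength (iaddp I y)) (fc : finite_colength (icolp I y)).

Let f J := (colength (iaddp J y) + colength (icolp J y))%N.

Lemma colength_addp_colp_lt J K : ideals_over I J -> ideals_over I K -> J `<` K -> (f K < f J)%N.
Proof.
move=> [iJ IJ] [iK IK] [JK KJ].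
have [iaJ iaK] := (is_ideal_addp y iJ, is_ideal_addp y iK).
have [icJ icK] := (is_ideal_colp y iJ, is_ideal_colp y iK).
have faJ := finite_colengthS (addpS (y := y) IJ) fa.
have fcJ := finite_colengthS (colpS (y := y) IJ) fc.
have aJK := addpS (y := y) JK; have cJK := colpS (y := y) JK.
have [sa|/contrapT ea] := pselect (~ (iaddp K y `<=` iaddp J y)).
  by rewrite /f -addSn leq_add // ?colength_lt // colengthS.
rewrite /f -addnS leq_add ?colengthS //; apply: colength_lt => //; split=> // ec.
apply: KJ => p Kp; have [a Jpa] := ea _ (sub_addp y Kp).
by apply: (idlBr iJ Jpa); apply: ec; apply: (idlBl iK (JK _ Jpa)).
Qed.

Lemma finite_colength_addp_colp : finite_colength I.
Proof.
exists (f I); apply: (chain_measure (f := f)); first exact: colength_addp_colp_lt.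
move=> J [iJ IJ]; rewrite leq_add // colengthS //.
- exact: is_ideal_addp.
- exact: is_ideal_addp.
- exact: addpS.
- exact: is_ideal_colp.
- exact: is_ideal_colp.
- exact: colpS.
Qed.

(** Additivity along 0 -> A/(I : y) -> A/I -> A/(I + (y)) -> 0. By the modular law [f] is strictly
    decreasing over [I], which bounds chains from above; splicing a chain from each end gives the
    lower bound. *)
Lemma colength_addp_colp : colength I = (colength (iaddp I y) + colength (icolp I y))%N.
Proof.
have fI := finite_colength_addp_colp.
have ia := is_ideal_addp y iI; have ic := is_ideal_colp y iI.
have [hI maxI] := colengthP iI fI.
apply/eqP; rewrite eqn_leq; apply/andP; split.
  apply: (chain_measure (f := f)) hI; first exact: colength_addp_colp_lt.
  move=> J [iJ IJ]; rewrite leq_add // colengthS //; try exact: is_ideal_addp.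
  - exact: addpS.
  - exact: is_ideal_colp.
  - exact: colpS.
apply: maxI.
have [[P [Pid Plt]] _] := colengthP ia fa.
have [[R [Rid Rlt]] _] := colengthP ic fc.
set p := colength (iaddp I y) in Pid Plt *; set r := colength (icolp I y) in Rid Rlt *.
(* [g J] is I + J y; it carries a chain over I : y to one between [I] and I + (y). *)
pose g (J : set A) : set A := [set z | exists2 a, J a & I (z - a * y)].
have gid J : is_ideal J -> is_ideal (g J).
  move=> iJ; split=> [|u v [a Ja Ia] [b Jb Ib]|a u [b Jb Ib]].
  - by exists 0; rewrite ?mul0r ?subr0; apply: idl0.
  - exists (a + b); first exact: idlD.
    have -> : u + v - (a + b) * y = (u - a * y) + (v - b * y) by ring.
    exact: idlD.
  - exists (a * b); first exact: idlMl.
    have -> : a * u - a * b * y = a * (u - b * y) by ring.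
    exact: idlMl.
have Ig J : is_ideal J -> I `<=` g J.
  by move=> iJ z Iz; exists 0; rewrite ?mul0r ?subr0 //; apply: idl0.
have gS J : g J `<=` iaddp I y by move=> z [a _ Ia]; exists a.
have glt i : (i < r)%N -> g (R i) `<` g (R i.+1).
  move=> ir; have [RR nRR] := Rlt i ir; split=> [z [a Ra Ia]|gg].
    by exists a => //; apply: RR.
  apply: nRR => a Ra; have [|b Rb Iab] := gg (a * y).
    by exists a => //; rewrite subrr; apply: idl0.
  have [iRi cRi] := Rid i (ltnW ir); apply: (idlBr iRi _ Rb); apply: cRi.
  by rewrite /icolp /= mulrBl.
(* [P 0] is skipped: it contains [g (R r)], so the spliced chain has exactly [p + r] steps. *)
exists (fun i => if (i <= r)%N then g (R i) else P (i - r)%N); split=> i.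
  case: ifP => ir ipr; first by have [iRi _] := Rid i ir; split; [apply: gid|apply: Ig].
  have [|iP IP] := Pid (i - r)%N; first by lia.
  by split=> //; apply: subset_trans IP; apply: sub_addp.
move=> ipr; case: ifP => ir; case: ifP => ir1; try lia.
- exact: glt.
- have -> : i = r by lia.
  rewrite subSnn; have [|P01 nP01] := Plt 0%N; first by lia.
  have [_ IP0] := Pid 0%N isT.
  split; first by apply: subset_trans (@gS _) _; apply: subset_trans P01.
  by move=> Pg; apply: nP01; apply: subset_trans Pg (subset_trans (@gS _) IP0).
- by rewrite subSn; [apply: Plt|]; lia.
Qed.

End Additivity.

Hypothesis noeth : noetherian A.
Variable m : set A.
Hypothesis locm : local_ring m.
Let im : is_ideal m := is_ideal_max locm.

Lemma finite_colength_max : finite_colength m.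
Proof.
exists 1%N => -[|[|k]] // [P [Pid Plt]]; have [_ _ maxm] := max_ideal_ax locm.
have [P01 nP01] := Plt 0%N isT; have [P12 nP12] := Plt 1%N isT.
have [iP1 mP1] := Pid 1%N isT; case: (maxm _ iP1 mP1) => P1.
  by case: nP01; rewrite P1; apply: (Pid 0%N isT).2.
by case: nP12; rewrite P1.
Qed.

Lemma colength_max : colength m = 1%N.
Proof.
apply/eqP; rewrite eqn_leq; apply/andP; split.
  have [[P [Pid Plt]] _] := colengthP im finite_colength_max.
  case: (colength m) Pid Plt => [|[|k]] // Pid Plt; have [_ _ maxm] := max_ideal_ax locm.
  have [P01 nP01] := Plt 0%N isT; have [P12 nP12] := Plt 1%N isT.
  have [iP1 mP1] := Pid 1%N isT; case: (maxm _ iP1 mP1) => P1.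
    by case: nP01; rewrite P1; apply: (Pid 0%N isT).2.
  by case: nP12; rewrite P1.
rewrite -{1}colengthT; apply: colength_lt => //; first exact: finite_colength_max.
by split=> // h; apply: (max_n1 locm); apply: h.
Qed.

(** The unit ideal qualifies, so the condition passes to all powers, the zeroth included, and to all
    larger ideals. *)
Definition max_primary (Q : set A) := is_ideal Q /\ forall x, m x -> exists n, Q (x ^+ n).

Lemma max_primaryS Q Q' : is_ideal Q' -> Q `<=` Q' -> max_primary Q -> max_primary Q'.
Proof. by move=> iQ' QQ' [_ h]; split=> // x /h[n Qn]; exists n; apply: QQ'. Qed.

(** Noetherian induction: for a maximal counterexample [J], a maximal colon J : y with [y] outside
    [J] contains [m], because every element of [m] has a power in [J]. Then J + (y) and J : y have
    finite colength, and so has [J] by additivity. *)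
Lemma max_primary_finite Q : max_primary Q -> finite_colength Q.
Proof.
move=> [iQ Qr]; apply: contrapT => nfQ.
have [||J [iJ QJ nfJ] maxJ] := @noetherian_max A noeth
  [set J | [/\ is_ideal J, Q `<=` J & ~ finite_colength J]].
- by move=> J [].
- by exists Q; split.
have nJ1 : ~ J 1 by move=> J1; apply: nfJ; rewrite (idlT iJ J1); apply: finite_colengthT.
have [||_ [y nJy <-] maxP] := @noetherian_max A noeth [set icolp J y | y in ~` J].
- by move=> _ [y _ <-]; apply: is_ideal_colp.
- by exists (icolp J 1), 1.
have iP := is_ideal_colp y iJ.
have mP : m `<=` icolp J y.
  move=> a ma; have [n /QJ Jn] := Qr a ma; apply: contrapT => nPa.
  have : J (a ^+ n * y) by exact: (idlMr y iJ Jn).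
  elim: n {Jn} => [|n IH]; first by rewrite expr0 mul1r.
  move=> Jn; apply: IH; apply: contrapT => nJ.
  apply: nPa; rewrite -(maxP (icolp J (a ^+ n * y))).
  - by rewrite /icolp /= mulrA -exprS.
  - by exists (a ^+ n * y).
  - by move=> b; rewrite /icolp /= mulrCA; apply: idlMl.
have [_ _ maxm] := max_ideal_ax locm.
apply: nfJ; apply: (@finite_colength_addp_colp _ y iJ).
  apply: contrapT => nfa; apply: nJy; rewrite -(maxJ (iaddp J y)).
  - exact: mem_addp.
  - split=> //; first exact: is_ideal_addp.
    exact: subset_trans QJ (@sub_addp _ _ _).
  - exact: sub_addp.
case: (maxm _ iP mP) => ->; [exact: finite_colength_max|exact: finite_colengthT].
Qed.

Lemma descending_chain (K : nat -> set A) Q : is_ideal Q -> finite_colength Q ->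
  (forall n, is_ideal (K n)) -> (forall n, Q `<=` K n) -> (forall n, K n.+1 `<=` K n) ->
  exists n, K n = K n.+1.
Proof.
move=> iQ fQ iK QK Kdec; apply: contrapT => nK.
have h n : (n <= colength (K n))%N.
  elim: n => // n IH; apply: (leq_ltn_trans IH); apply: colength_lt => //.
    exact: finite_colengthS fQ.
  by split=> // KK; apply: nK; exists n; apply/seteqP.
have := leq_trans (h (colength Q).+1) (colengthS iQ (iK _) fQ (QK _)).
by rewrite ltnn.
Qed.

(** Two consecutive members of the descending chain Q + m^n agree; then m^n lies in Q + m m^n and
    Nakayama applies. *)
Lemma max_primary_exp Q : max_primary Q -> exists k, ideal_exp m k `<=` Q.
Proof.
move=> pQ; have [iQ _] := pQ.
have ie n := is_ideal_exp n im.
have [|||n Kn] := @descending_chain (fun n => iadd Q (ideal_exp m n)) Q iQ (max_primary_finite pQ).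
- by move=> n; apply: is_ideal_add.
- by move=> n; apply: iadd_subl.
- by move=> n u [w mw Qw]; exists w => //; apply: ideal_expSl mw.
exists n; apply: (nakayama noeth locm) => // u mu.
have : iadd Q (ideal_exp m n.+1) u by rewrite -Kn; apply: iadd_subr.
by case=> w; rewrite ideal_expS // => mw Qw; exists w.
Qed.

(* The heart of Krull's principal ideal theorem: the ideals (c, y^n) : x^oo play the role of
   symbolic powers. *)
Lemma principal_ideal_power (c : set A) x y : is_ideal c -> m x ->
  max_primary (iaddp c x) -> m y ->
  exists n k, iaddp c (y ^+ n.+1) (x ^+ k * y ^+ n).
Proof.
move=> ic mx pcx my.
pose K n : set A := [set u | exists k, iaddp c (y ^+ n) (x ^+ k * u)].
have ia n := is_ideal_addp (y ^+ n) ic.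
have iK n : is_ideal (K n).
  split=> [|u v [k Ku] [j Kv]|a u [k Ku]].
  - by exists 0%N; rewrite mulr0; apply: idl0.
  - exists (k + j)%N; rewrite exprD.
    have -> : x ^+ k * x ^+ j * (u + v) = x ^+ j * (x ^+ k * u) + x ^+ k * (x ^+ j * v) by ring.
    by apply: idlD => //; apply: idlMl.
  - by exists k; rewrite mulrCA; apply: idlMl.
have cK n : c `<=` K n.
  by move=> u cu; exists 0%N; rewrite mul1r; apply: sub_addp.
have Kdec n : K n.+1 `<=` K n.
  move=> u [k [a ca]]; exists k, (a * y).
  by have -> : x ^+ k * u - a * y * y ^+ n = x ^+ k * u - a * y ^+ n.+1 by rewrite exprS; ring.
have [|||n Kn] := @descending_chain (fun n => iaddp (K n) x) _ (is_ideal_addp x ic)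
  (max_primary_finite pcx).
- by move=> n; apply: is_ideal_addp.
- by move=> n; apply: addpS.
- by move=> n; apply: addpS.
(* Modulo [K n.+1] an element of [K n] is a x; as [K n] is saturated with respect to [x], [a] is
   again in [K n], and Nakayama applies. *)
have KK : K n `<=` K n.+1.
  apply: (nakayama1 noeth locm) mx _ => // u Ku.
  have : iaddp (K n.+1) x u by rewrite -Kn; apply: sub_addp.
  case=> a Ka; exists a; last by rewrite mulrC.
  have [k ck] : K n (a * x) by apply: (idlBl (iK n) (Kdec n _ Ka)).
  by exists k.+1; rewrite exprS; have -> : x * x ^+ k * a = x ^+ k * (a * x) by ring.
have [|k h] := KK (y ^+ n); last by exists n, k.
by exists 0%N; rewrite mul1r; apply: mem_addp.
Qed.

End Length.

(** * Hilbert-Samuel polynomials *)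

Section EventuallyPolynomial.
Implicit Types (p : {poly rat}) (f g : nat -> rat) (n k r : nat).

Definition evpoly r f :=
  exists2 p : {poly rat}, (size p <= r)%N & exists n0, forall n, (n0 <= n)%N -> p.[n%:R] = f n.

Lemma evpoly_ext r f g k : (forall n, (k <= n)%N -> f n = g n) -> evpoly r f -> evpoly r g.
Proof.
move=> fg [p pr [n0 pf]]; exists p => //; exists (maxn k n0) => n.
by rewrite geq_max => /andP[kn n0n]; rewrite pf // fg.
Qed.

Lemma evpolyW r f : evpoly r f -> evpoly r.+1 f.
Proof. by move=> [p pr pf]; exists p => //; apply: leqW. Qed.

Lemma evpoly_add r f g : evpoly r f -> evpoly r g -> evpoly r (fun n => f n + g n).
Proof.
move=> [p pr [n0 pf]] [q qr [n1 qg]]; exists (p + q).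
  by rewrite (leq_trans (size_polyD _ _)) // geq_max pr.
by exists (maxn n0 n1) => n; rewrite geq_max => /andP[? ?]; rewrite hornerD pf ?qg.
Qed.

Lemma evpoly_sum_ord r k (F : nat -> nat -> rat) : (forall i, evpoly r (F i)) ->
  evpoly r (fun n => \sum_(i < k) F i n).
Proof.
move=> pF; elim: k => [|k IH].
  exists 0; first by rewrite size_poly0.
  by exists 0%N => n _; rewrite horner0 big_ord0.
apply: (evpoly_ext (k := 0)) (evpoly_add IH (pF k)) => n _.
by rewrite big_ord_recr.
Qed.

Lemma evpoly_shift r f k : evpoly r f -> evpoly r (fun n => f (n - k)%N).
Proof.
move=> [p pr [n0 pf]]; exists (p \Po ('X - k%:R%:P)).
  by rewrite size_comp_poly2 // size_XsubC.
exists (n0 + k)%N => n kn.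
have ? : (k <= n)%N by lia.
by rewrite horner_comp hornerXsubC -natrB // pf //; lia.
Qed.

Lemma antidifference r p : (size p <= r)%N ->
  exists2 q : {poly rat}, (size q <= r.+1)%N & forall x, q.[x + 1] - q.[x] = p.[x].
Proof.
elim: r p => [|r IH] p pr.
  exists 0; first by rewrite size_poly0.
  by move=> x; move: pr; rewrite leqn0 size_poly_eq0 => /eqP->; rewrite !horner0 subrr.
(* [D] is (X+1)^(r+1) - X^(r+1), of degree [r] with leading coefficient r+1; a multiple of it
   removes the top term of [p]. *)
pose D : {poly rat} := \sum_(i < r.+1) 'X^i *+ 'C(r.+1, i).
have DE x : D.[x] = (x + 1) ^+ r.+1 - x ^+ r.+1.
  rewrite exprD1n big_ord_recr /= binn mulr1n addrK horner_sum.
  by apply: eq_bigr => i _; rewrite hornerMn hornerXn.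
have Dr : D`_r = r.+1%:R.
  rewrite coef_sum big_ord_recr /= coefMn coefXn eqxx binSn big1 ?add0r // => i _.
  by rewrite coefMn coefXn gtn_eqF ?mul0rn.
have Dsz i : (r < i)%N -> D`_i = 0.
  move=> ri; rewrite coef_sum big1 // => j _.
  by rewrite coefMn coefXn gtn_eqF ?mul0rn //; have := ltn_ord j; lia.
pose c := p`_r / r.+1%:R.
have nz : r.+1%:R != 0 :> rat by rewrite pnatr_eq0.
have [|q qr qE] := IH (p - c *: D).
  apply/leq_sizeP => j rj; rewrite coefB coefZ.
  move: rj; rewrite leq_eqVlt => /predU1P[<-|rj]; first by rewrite Dr /c divfK // subrr.
  by rewrite Dsz // mulr0 subr0 nth_default // (leq_trans pr).
exists (q + c *: 'X^(r.+1)).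
  rewrite (leq_trans (size_polyD _ _)) // geq_max (leqW qr) /=.
  by rewrite (leq_trans (size_scale_leq _ _)) // size_polyXn.
move=> x; rewrite !hornerD !hornerZ !hornerXn.
have := qE x; rewrite hornerD hornerN hornerZ DE => h.
have -> : q.[x + 1] + c * (x + 1) ^+ r.+1 - (q.[x] + c * x ^+ r.+1)
  = (q.[x + 1] - q.[x]) + c * ((x + 1) ^+ r.+1 - x ^+ r.+1) by ring.
by rewrite h subrK.
Qed.

Lemma evpoly_psum r f : evpoly r f -> evpoly r.+1 (fun n => \sum_(j < n) f j).
Proof.
move=> [p pr [n0 pf]]; have [q qr qE] := antidifference pr.
pose c := \sum_(j < n0) f j - q.[n0%:R].
exists (q + c%:P).
  rewrite (leq_trans (size_polyD _ _)) // geq_max qr /= size_polyC.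
  by case: (c == 0).
exists n0 => n /subnKC <-; elim: (n - n0)%N => [|k IH].
  by rewrite addn0 hornerD hornerC /c addrC subrK.
rewrite addnS big_ord_recr /= -IH -pf ?leq_addr // -qE !hornerD !hornerC.
by rewrite -natr1; ring.
Qed.

End EventuallyPolynomial.

(** * Exponent vectors and their lexicographic order *)

Section Monomials.

(* The exponent vectors of the monomials of degree n in d variables, in lexicographic order. *)
Fixpoint mons d n : seq (seq nat) :=
  if d is d'.+1 then
    flatten [seq [seq k :: b | b <- mons d' (n - k)%N] | k <- iota 0 n.+1]
  else if n is 0 then [:: [::]] else [::].

Fixpoint ltlex (a b : seq nat) : bool :=
  match a, b with
  | i :: a', j :: b' => (i < j)%N || (i == j) && ltlex a' b'
  | _, _ => false
  end.

Lemma monsS d n :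
  mons d.+1 n = flatten [seq [seq k :: b | b <- mons d (n - k)%N] | k <- iota 0 n.+1].
Proof. by []. Qed.

Lemma mem_mons d n a : (a \in mons d n) = (size a == d) && (sumn a == n).
Proof.
elim: d n a => [|d IH] n a.
  by case: n a => [|n] [|k a].
rewrite monsS.
apply/flattenP/idP.
  move=> [_ /mapP[k + ->] /mapP[b + ->]]; rewrite mem_iota IH => kn /andP[/eqP sb /eqP nb] /=.
  by rewrite eqSS sb eqxx nb; apply/eqP; lia.
case: a => [|k b] // /andP[sb /eqP nb]; have {}nb : (k + sumn b)%N = n := nb.
exists [seq k :: b0 | b0 <- mons d (n - k)%N].
  by apply/mapP; exists k => //; rewrite mem_iota; lia.
apply/mapP; exists b => //; rewrite IH; move: sb; rewrite eqSS => -> /=; apply/eqP; lia.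
Qed.

Lemma ltlexx a : ltlex a a = false.
Proof. by elim: a => //= i a ->; rewrite ltnn eqxx. Qed.

Lemma ltlex_asym a b : ltlex a b -> ltlex b a = false.
Proof.
elim: a b => [|i a IH] [|j b] //= /orP[ij|/andP[/eqP-> /IH ->]].
  by rewrite gtn_eqF // ltnNge (ltnW ij).
by rewrite ltnn eqxx.
Qed.

Lemma pairwise_mons d n : pairwise ltlex (mons d n).
Proof.
elim: d n => [|d IH] n; first by case: n.
rewrite monsS.
have : pairwise ltn (iota 0 n.+1) by rewrite -(sorted_pairwise ltn_trans) iota_ltn_sorted.
elim: (iota _ _) => //= k s IHs /andP[ks ss]; rewrite pairwise_cat IHs // andbT.
apply/andP; split.
  apply/allrelP => _ _ /mapP[b _ ->] /flattenP[_ /mapP[j js ->] /mapP[c _ ->]] /=.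
  by have /allP/(_ _ js)/= -> := ks.
rewrite pairwise_map; have := IH (n - k)%N; apply: sub_pairwise => b c /= ->.
by rewrite eqxx orbT.
Qed.

Definition addmon (a b : seq nat) := [seq p.1 + p.2 | p <- zip a b]%N.

Lemma size_addmon a b : size a = size b -> size (addmon a b) = size b.
Proof. by move=> ab; rewrite size_map size_zip ab minnn. Qed.

Lemma sumn_addmon a b : size a = size b -> sumn (addmon a b) = (sumn a + sumn b)%N.
Proof. by elim: a b => [|i a IH] [|j b] //= [ab]; rewrite -/(addmon a b) IH //; lia. Qed.

Lemma ltlex_add a b c : size a = size c -> size b = size c ->
  ltlex (addmon a c) (addmon b c) = ltlex a b.
Proof.
elim: a b c => [|i a IH] [|j b] [|k c] //= [ac] [bc].
by rewrite -/(addmon a c) -/(addmon b c) IH // ltn_add2r eqn_add2r.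
Qed.

Definition lemon (a b : seq nat) := forall i, (nth 0 a i <= nth 0 b i)%N.

Lemma lemon_addP a b : size a = size b -> lemon a b ->
  exists2 c, size c = size b & b = addmon a c.
Proof.
elim: a b => [|i a IH] [|j b] //= => [_ _|[ab] le]; first by exists [::].
have [|c sc bE] := IH b ab; first by move=> k; apply: (le k.+1).
exists ((j - i)%N :: c) => /=; first by rewrite sc.
by rewrite bE /addmon /= subnKC //; apply: (le 0%N).
Qed.

End Monomials.

(** * Families of ideals increasing in the exponent vector *)

Section MonotoneFamilies.
Variable A : comNzRingType.
Hypothesis noeth : noetherian A.

Let truncmon k (a : seq nat) := [seq minn k i | i <- a].

Lemma bounded_box d k (f : seq nat -> nat) :
  exists n, forall a, size a = d -> all (fun i => i <= k)%N a -> (f a <= n)%N.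
Proof.
elim: d f => [|d IH] f.
  by exists (f [::]) => a /size0nil ->.
have [g gf] := choice (fun i => IH (fun a => f (i :: a))).
exists (\max_(i < k.+1) g i) => -[|i a] //= [sa] /andP[ik ak].
by apply: leq_trans (leq_bigmax (Ordinal (ik : (i < k.+1)%N))); apply: gf.
Qed.

(* Noetherianity of the polynomial ring, read off on ideals of leading coefficients. *)
Lemma monotone_truncation d (L : seq nat -> set A) :
  (forall a, size a = d -> is_ideal (L a)) ->
  (forall a b, size a = d -> size b = d -> lemon a b -> L a `<=` L b) ->
  exists k, forall a, size a = d -> L a = L (truncmon k a).
Proof.
elim: d L => [|d IH] L iL Lmon; first by exists 0%N => a /size0nil ->.
have consmon i j a b : size a = d -> size b = d -> (i <= j)%N -> lemon a b ->
    L (i :: a) `<=` L (j :: b).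
  by move=> sa sb ij ab; apply: Lmon => /= [||[|k]] //=; rewrite ?sa ?sb.
have lemonn a : lemon a a by move=> i.
have st a : exists k, size a = d -> forall n, (k <= n)%N -> L (n :: a) = L (k :: a).
  have [sa|nsa] := pselect (size a = d); last by exists 0%N.
  have [|n|k hk] := noetherian_chain noeth (I := fun n => L (n :: a)).
  - by move=> n; apply: iL => /=; rewrite sa.
  - exact: consmon.
  - by exists k.
have {st}[kk kkE] := choice st.
have SE a i : size a = d -> (kk a <= i)%N -> L (i :: a) = L (kk a :: a) by move=> sa; apply: kkE.
pose S a := L (kk a :: a).
have LS i a : size a = d -> L (i :: a) `<=` S a.
  move=> sa; rewrite /S -(SE a (maxn i (kk a))) ?leq_maxr //.
  by apply: consmon; rewrite ?leq_maxl.
have [||k' Sk'] := IH S.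
- by move=> a sa; apply: iL; rewrite /= sa.
- move=> a b sa sb ab; rewrite /S -(SE b (maxn (kk a) (kk b))) ?leq_maxr //.
  by apply: consmon; rewrite ?leq_maxl.
(* [S a], the union of the [L (i :: a)], depends only on [a] truncated at [k']. Over this finite box
   the stabilisation points [kk] have a common bound [k0], which by monotonicity serves for all
   [a]. *)
have [k0 hk0] := bounded_box d k' kk.
have truncle k a : lemon (truncmon k a) a.
  move=> i; have [ia|ia] := ltnP i (size a).
    by rewrite (nth_map 0%N) // geq_minr.
  by rewrite nth_default ?size_map.
have truncK j k a : (j <= k)%N -> truncmon j (truncmon k a) = truncmon j a.
  by move=> jk; rewrite /truncmon -map_comp; apply: eq_map => i /=; lia.
have AS i a : size a = d -> (k0 <= i)%N -> L (i :: a) = S a.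
  move=> sa k0i; apply/seteqP; split; first exact: LS.
  have st : size (truncmon k' a) = d by rewrite size_map.
  rewrite (Sk' a sa) /S -(SE _ i) //; first exact: consmon.
  apply: leq_trans k0i; apply: hk0 => //.
  by apply/allP => _ /mapP[x _ ->]; rewrite geq_minl.
have hL i : exists k, forall a, size a = d -> L (i :: a) = L (i :: truncmon k a).
  apply: (IH (fun a => L (i :: a))) => [a sa|a b sa sb ab]; first by apply: iL => /=; rewrite sa.
  exact: consmon.
have {hL}[kf kfE] := choice hL.
pose k := maxn k' (maxn k0 (\max_(i < k0) kf i)).
exists k => -[|i a] //= [sa].
have st : size (truncmon k a) = d by rewrite size_map.
have [k0i|ik0] := leqP k0 i.
  rewrite AS // AS //; last by rewrite /k; lia.
  by rewrite (Sk' a sa) (Sk' _ st) truncK // leq_maxl.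
have -> : minn k i = i by rewrite /k; lia.
rewrite (kfE i a sa) (kfE i _ st) truncK //.
have := @leq_bigmax _ (fun i : 'I_k0 => kf i) (Ordinal ik0); rewrite /k /=; lia.
Qed.

(** Slice by the first exponent. Each of finitely many small values gives a shift of an eventually
    polynomial function from one variable less; beyond them all slices coincide and add up to
    partial sums of a single such function, which raises the degree by at most one. *)
Lemma monotone_evpoly d (L : seq nat -> set A) (phi : set A -> rat) :
  (forall a, size a = d -> is_ideal (L a)) ->
  (forall a b, size a = d -> size b = d -> lemon a b -> L a `<=` L b) ->
  evpoly d (fun n => \sum_(a <- mons d n) phi (L a)).
Proof.
elim: d L => [|d IH] L iL Lmon.
  exists 0; rewrite ?size_poly0 //; exists 1%N => -[|n] // _.
  by rewrite horner0 big_nil.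
have [k kE] := monotone_truncation iL Lmon.
have stab i a : size a = d -> (k <= i)%N -> L (i :: a) = L (k :: a).
  by move=> sa ki; rewrite (kE (i :: a)) ?(kE (k :: a)) /= ?sa // minnn (minn_idPl ki).
pose g i n := \sum_(a <- mons d n) phi (L (i :: a)).
have pg i : evpoly d (g i).
  apply: (IH (fun a => L (i :: a))) => [a sa|a b sa sb ab]; first by apply: iL => /=; rewrite sa.
  by apply: Lmon => /= [||[|j]] //=; rewrite ?sa ?sb.
have p1 : evpoly d.+1 (fun n => \sum_(i < k) g i (n - i)%N).
  apply: evpolyW; apply: (@evpoly_sum_ord d k (fun i n => g i (n - i)%N)) => i.
  exact: (evpoly_shift i (pg i)).
have p2 : evpoly d.+1 (fun n => \sum_(j < (n.+1 - k)) g k j).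
  have := evpoly_psum (pg k); move/(evpoly_shift k) => /= [p pr [n0 hp]].
  exists (p \Po ('X + 1%:P)); first by rewrite size_comp_poly2 // size_XaddC.
  exists n0 => n n0n; rewrite horner_comp hornerD hornerX hornerC natr1 hp //; lia.
apply: (evpoly_ext (k := k)) (evpoly_add p1 p2) => n kn.
rewrite monsS big_flatten big_map -[iota 0 n.+1]/(index_iota 0 n.+1).
under [RHS]eq_bigr do rewrite big_map.
rewrite [RHS](big_cat_nat (n := k)) //=; last by lia.
congr (_ + _); first by rewrite big_mkord.
have revE (F : nat -> rat) :
    \sum_(k <= i < n.+1) F i = \sum_(0 <= j < n.+1 - k) F (n - j)%N.
  rewrite big_nat_rev /= -{1}[k]add0n big_addn.
  by apply: eq_big_nat => j /andP[_ jn]; congr F; lia.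
rewrite revE -(big_mkord xpredT (fun j => g k j)).
apply: eq_big_nat => j /andP[_ jn]; rewrite /g.
have -> : (n - (n - j))%N = j by lia.
rewrite big_seq [RHS]big_seq; apply: eq_bigr => a; rewrite mem_mons => /andP[/eqP sa _].
by rewrite [in RHS]stab //; lia.
Qed.

End MonotoneFamilies.

(** * Hilbert-Samuel polynomials and multiplicities of powers of parameters *)

Section HilbertSamuel.
Variable A : comNzRingType.
Implicit Types (I J K Q : set A) (s : seq A).

Definition mon s (a : seq nat) : A := \prod_(p <- zip s a) p.1 ^+ p.2.

Lemma mon_cons x s k (a : seq nat) : mon (x :: s) (k :: a) = x ^+ k * mon s a.
Proof. by rewrite /mon /= big_cons. Qed.

Lemma mon_nil (a : seq nat) : mon [::] a = 1.
Proof. by rewrite /mon; case: a => [|k a] /=; rewrite big_nil. Qed.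

Lemma mon_add s (a b : seq nat) : size a = size s -> size b = size s ->
  mon s (addmon a b) = mon s a * mon s b.
Proof.
elim: s a b => [|x s IH] [|i a] [|j b] //=; first by rewrite !mon_nil mulr1.
move=> [sa] [sb]; rewrite /addmon /= -/(addmon a b) !mon_cons IH // exprD.
by ring.
Qed.

Lemma mon_exp Q s (a : seq nat) : is_ideal Q -> [set` s] `<=` Q -> size a = size s ->
  ideal_exp Q (sumn a) (mon s a).
Proof.
move=> iQ; elim: s a => [|x s IH] [|k a] //= sQ [sa].
rewrite mon_cons; apply: ideal_expD => //.
  by apply: ideal_expX => //; apply: sQ; rewrite /= mem_head.
by apply: IH => // z zs; apply: sQ; rewrite /= inE; apply/orP; right.
Qed.

Lemma mon_incr s (a : seq nat) i : size a = size s -> (i < size s)%N ->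
  mon s (incr_nth a i) = nth 0 s i * mon s a.
Proof.
elim: s a i => [|x s IH] [|k a] [|i] //= [sa] il; rewrite !mon_cons ?exprS ?mulrA //.
by rewrite IH // mulrCA mulrA.
Qed.

Lemma sumn_incr_nth (a : seq nat) i : sumn (incr_nth a i) = (sumn a).+1.
Proof.
elim: a i => [|k a IH] [|i] //=; last by rewrite IH addnS.
by elim: i.
Qed.

Definition monset s n : set A := [set mon s a | a in [set a | size a = size s /\ sumn a = n]].

Lemma ideal_exp_gen s n : ideal_exp (ideal_gen [set` s]) n = ideal_gen (monset s n).
Proof.
have iQ := is_ideal_gen [set` s]; apply/seteqP; split; last first.
  apply: ideal_gen_sub; first exact: is_ideal_exp.
  move=> _ [a [sa <-] <-]; apply: mon_exp => //; exact: ideal_genP.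
elim: n => [|n IH].
  move=> z _; rewrite (idlT (is_ideal_gen (monset s 0))) //; apply: ideal_genP.
  exists (nseq (size s) 0%N); first by rewrite /= size_nseq sumn_nseq.
  by elim: s {iQ} => [|x s IH]; rewrite ?mon_nil //= mon_cons IH mul1r.
rewrite ideal_expS //; apply: ideal_mul_sub => [|x y Qx]; first exact: is_ideal_gen.
move=> /IH; rewrite mulrC; move: y.
suff: ideal_gen [set` s] `<=` ideal_colon (ideal_gen (monset s n.+1)) (ideal_gen (monset s n)).
  by move=> /(_ x Qx) h y /h; rewrite mulrC.
have iM := is_ideal_gen (monset s n.+1).
apply: ideal_gen_sub; first exact: is_ideal_colon.
move=> z /= zs y my; rewrite mulrC.
suff: ideal_gen (monset s n) `<=` icolp (ideal_gen (monset s n.+1)) z by apply.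
apply: ideal_gen_sub; first exact: is_ideal_colp.
move=> _ [a [sa <-] <-]; rewrite /icolp /= mulrC; apply: ideal_genP.
have iz : (index z s < size s)%N by rewrite index_mem.
exists (incr_nth a (index z s)); last by rewrite mon_incr // nth_index.
by rewrite /= size_incr_nth sa iz sumn_incr_nth.
Qed.

(** Additivity iterated along [r]. The relation [lt] describes the elements already added without
    reference to positions, so that colon ideals coming from different lists can be compared. *)
Lemma colength_filtration (T : eqType) (lt : rel T) (y : T -> A) (r : seq T) J :
  irreflexive lt -> (forall a b : T, lt a b -> lt b a = false) -> pairwise lt r ->
  is_ideal J -> finite_colength J ->
  colength J = (colength (ideal_gen (J `|` [set y b | b in [set` r]])) +
    \sum_(a <- r) colength (icolp
      (ideal_gen (J `|` [set y b | b in [set b : T | b \in r /\ lt b a]])) (y a)))%N.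
Proof.
move=> ltxx ltN; elim: r J => [|a r IH] J.
  move=> _ iJ _; rewrite big_nil addn0; congr colength.
  apply/seteqP; split=> [z Jz|]; first by apply: ideal_genP; left.
  by apply: ideal_gen_sub => // z [|[b]].
rewrite pairwise_cons => /andP[/allP ar rr] iJ fJ.
have ia := is_ideal_addp (y a) iJ.
rewrite (colength_addp_colp iJ (finite_colengthS (sub_addp (y a)) fJ)
  (finite_colengthS (sub_colp (y a) iJ) fJ)).
have {}IH := IH (iaddp J (y a)) rr ia (finite_colengthS (sub_addp (y a)) fJ).
have genE (P P' : set T) : (forall b : T, P b <-> b = a \/ P' b) ->
  ideal_gen (iaddp J (y a) `|` [set y b | b in P']) = ideal_gen (J `|` [set y b | b in P]).
  move=> PP'; have ig := is_ideal_gen (J `|` [set y b | b in P]).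
  apply/seteqP; split; apply: ideal_gen_sub => //; try exact: is_ideal_gen.
  - move=> z [|[b P'b <-]].
      apply: addp_sub => // [u Ju|]; apply: ideal_genP; [by left|].
      by right; exists a => //; apply/PP'; left.
    by apply: ideal_genP; right; exists b => //; apply/PP'; right.
  - move=> z [Jz|[b /PP'[->|P'b] <-]]; apply: ideal_genP.
    + by left; apply: sub_addp.
    + by left; apply: mem_addp.
    + by right; exists b.
rewrite IH big_cons (genE [set` a :: r]); last first.
  move=> b /=; rewrite inE; split=> [/predU1P|h]; first by [].
  by apply/predU1P.
rewrite -!addnA; congr (_ + _)%N; rewrite addnC; congr (_ + _)%N.
  congr colength; congr icolp; apply/seteqP; split=> [z Jz|].
    by apply: ideal_genP; left.
  apply: ideal_gen_sub => // z [//|[b [br ba] _]]; exfalso; move: br ba.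
  by rewrite inE => /predU1P[->|/ar/ltN -> //]; rewrite ltxx.
rewrite big_seq [RHS]big_seq; apply: eq_bigr => b br.
rewrite (genE [set c : T | c \in a :: r /\ lt c b]) // => c /=; rewrite inE.
split=> [[/predU1P[->|cr] cb]|[->|[cr cb]]]; rewrite ?eqxx ?ar ?cr ?orbT //; first by left.
by right.
Qed.

Variable m : set A.
Hypothesis noeth : noetherian A.
Hypothesis locm : local_ring m.

Lemma max_primary_exp_ideal Q n : max_primary m Q -> max_primary m (ideal_exp Q n).
Proof.
move=> [iQ Qr]; split; first exact: is_ideal_exp.
by move=> x /Qr[k Qk]; exists (k * n)%N; rewrite exprM; apply: ideal_expX.
Qed.

(** Between Q^(n+1) and Q^n the monomials of degree n are added in lexicographic order, the one with
    exponent [a] contributing the length of A/[L a]. Multiplication by a monomial preserves the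
    order, so [L] is monotone and [monotone_evpoly] governs the length of Q^n/Q^(n+1). *)
Lemma hilbert_samuel s : max_primary m (ideal_gen [set` s]) ->
  evpoly (size s).+1 (fun n => (colength (ideal_exp (ideal_gen [set` s]) n.+1))%:R).
Proof.
set Q := ideal_gen _ => pQ; have iQ : is_ideal Q by case: pQ.
have fQ n := max_primary_finite noeth locm (max_primary_exp_ideal n pQ).
have ie n := is_ideal_exp n iQ.
pose V a := ideal_gen (ideal_exp Q (sumn a).+1 `|`
  [set mon s b | b in [set b | b \in mons (size s) (sumn a) /\ ltlex b a]]).
pose L a := icolp (V a) (mon s a).
have iL a : is_ideal (L a) by apply: is_ideal_colp; apply: is_ideal_gen.
have Lmon a b : size a = size s -> size b = size s -> lemon a b -> L a `<=` L b.
  move=> sa sb ab; have [c sc bE] := lemon_addP (etrans sa (esym sb)) ab.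
  rewrite sb in sc.
  have VV : V a `<=` icolp (V b) (mon s c).
    have iV : is_ideal (V b) by apply: is_ideal_gen.
    apply: ideal_gen_sub; first exact: is_ideal_colp.
    have bn : sumn b = (sumn a + sumn c)%N by rewrite bE sumn_addmon ?sa ?sc.
    move=> z [Qz|[e [+ ea] <-]].
      apply: ideal_genP; left; rewrite bn -addSn; apply: ideal_expD => //.
      by apply: mon_exp => //; apply: ideal_genP.
    rewrite mem_mons => /andP[/eqP se /eqP ne].
    apply: ideal_genP; right; exists (addmon e c); last by rewrite mon_add.
    split; first by rewrite mem_mons size_addmon ?sumn_addmon ?se ?sc // bn ne !eqxx.
    by rewrite bE ltlex_add ?se ?sa ?sc.
  move=> z /VV; rewrite /L /icolp /= bE mon_add ?mulrA //.
have step n : colength (ideal_exp Q n.+1) =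
    (colength (ideal_exp Q n) + \sum_(a <- mons (size s) n) colength (L a))%N.
  rewrite (colength_filtration (mon s) ltlexx ltlex_asym (pairwise_mons (size s) n) (ie n.+1) (fQ n.+1)).
  congr (colength _ + _)%N.
    apply/seteqP; split.
      apply: ideal_gen_sub => // z [|[a /= + <-]]; first exact: ideal_expSl.
      rewrite mem_mons => /andP[/eqP sa /eqP <-]; apply: mon_exp => //; exact: ideal_genP.
    rewrite {1}ideal_exp_gen; apply: ideal_gen_sub; first exact: is_ideal_gen.
    move=> _ [a [sa na] <-]; apply: ideal_genP; right; exists a => //=.
    by rewrite mem_mons sa na !eqxx.
  rewrite big_seq [RHS]big_seq; apply: eq_bigr => a; rewrite mem_mons => /andP[_ /eqP na].
  by rewrite /L /V na.
have pL := monotone_evpoly noeth (fun I => (colength I)%:R) (fun a _ => iL a) Lmon.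
have [p pr [n0 hp]] := evpoly_psum pL.
exists (p \Po ('X + 1%:P)); first by rewrite size_comp_poly2 // size_XaddC.
exists n0 => n n0n; rewrite horner_comp hornerD hornerX hornerC natr1 hp; last by lia.
elim: n.+1 => [|k IH]; first by rewrite big_ord0 colengthT.
by rewrite big_ord_recr /= IH step natrD natr_sum.
Qed.

Lemma poly_eq_eventually (p q : {poly rat}) n0 :
  (forall n, (n0 <= n)%N -> p.[n%:R] = q.[n%:R]) -> p = q.
Proof.
move=> pq; apply/eqP; rewrite -subr_eq0; apply/eqP/eqP; apply: contraT => nz.
have := max_poly_roots nz (rs := [seq i%:R | i <- iota n0 (size (p - q)%R)]).
rewrite size_map size_iota ltnn => -> //.
  apply/allP => _ /mapP[i + ->]; rewrite mem_iota => /andP[n0i _].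
  by rewrite rootE hornerD hornerN pq // subrr.
by rewrite map_inj_uniq ?iota_uniq // => i j /eqP; rewrite eqr_nat => /eqP.
Qed.

(** [xget] selects an unspecified polynomial; polynomials agreeing at all large integers are equal,
    which transfers the degree bound to it. *)
Lemma hilbert_samuel_polyP s : max_primary m (ideal_gen [set` s]) ->
  let p := hilbert_samuel_poly (ideal_gen [set` s]) in
  (size p <= (size s).+1)%N /\
  exists n0, forall n, (n0 <= n)%N -> p.[n%:R] = (colength (ideal_exp (ideal_gen [set` s]) n.+1))%:R.
Proof.
move=> /hilbert_samuel[q qs [n0 qE]] p.
have [n1 pE] : exists n1, forall n, (n1 <= n)%N ->
    p.[n%:R] = (colength (ideal_exp (ideal_gen [set` s]) n.+1))%:R.
  apply: (@xgetI _ 0 [set p : {poly rat} | exists n1, forall n, (n1 <= n)%N ->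
    p.[n%:R] = (colength (ideal_exp (ideal_gen [set` s]) n.+1))%:R] q).
  by exists n0.
split; last by exists n1.
have -> // : p = q.
by apply: (poly_eq_eventually (n0 := maxn n0 n1)) => n h; rewrite pE ?qE //; lia.
Qed.

Lemma rat_archimedean (x y : rat) n0 :
  (forall n, (n0 <= n)%N -> 0 <= x * n%:R + y) -> 0 <= x.
Proof.
move=> h; rewrite leNgt; apply/negP => x0.
pose k := (n0 + Num.bound (`|y| / - x))%N.
have := h k (leq_addr _ _).
have xN : 0 < - x by rewrite oppr_gt0.
have : `|y| / - x < k%:R.
  apply: (lt_le_trans (archi_boundP _)); first by rewrite divr_ge0 // ltW.
  by rewrite ler_nat leq_addl.
rewrite ltr_pdivrMr // mulrN => ky.
rewrite leNgt => /negP; apply; rewrite -ltrBrDr sub0r.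
have := ler_norm y; rewrite -lerN2 => /(lt_le_trans _); apply.
by rewrite ltrNr mulrC.
Qed.

Lemma lead_coef_ge0 d (p : {poly rat}) n0 : (size p <= d.+1)%N ->
  (forall n, (n0 <= n)%N -> 0 <= p.[n%:R]) -> 0 <= p`_d.
Proof.
move=> sp p0; apply: (rat_archimedean (n0 := maxn 1 n0) (y := \sum_(i < d) `|p`_i|)) => n.
rewrite geq_max => /andP[n1 n0n].
have n0' : 0 < n%:R :> rat by rewrite ltr0n.
(* In n p(n) the lower terms have powers n^(i+1) with [i < d], at most n^d; dividing by n^d leaves a
   bound linear in [n]. *)
rewrite -(pmulr_rge0 _ (exprn_gt0 d n0')).
apply: (le_trans (mulr_ge0 (ltW n0') (p0 n n0n))).
rewrite (horner_coef_wide _ sp) big_ord_recr /= mulrDr mulrDr addrC lerD //.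
  by rewrite le_eqVlt; apply/orP; left; apply/eqP; ring.
rewrite !mulr_sumr; apply: ler_sum => i _.
rewrite mulrCA mulrC -exprS; apply: (@le_trans _ _ (n%:R ^+ i.+1 * `|p`_i|)).
  by apply: ler_wpM2l; [rewrite exprn_ge0 // ltW|apply: ler_norm].
by apply: ler_wpM2r => //; apply: ler_weXn2l => //; rewrite ler1n.
Qed.

Lemma ideal_exp_exp Q n k : is_ideal Q ->
  ideal_exp (ideal_exp Q n) k `<=` ideal_exp Q (n * k).
Proof.
move=> iQ; have ie j := is_ideal_exp j iQ.
elim: k => [|k IH]; first by rewrite muln0.
rewrite ideal_expS // mulnS; apply: ideal_mul_sub => // x y Qx /IH Qy.
exact: ideal_expD.
Qed.

Definition spow n s := [seq x ^+ n | x <- s].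

Lemma mon_spow n s (a : seq nat) : size a = size s ->
  mon s a = mon (spow n s) [seq (i %/ n)%N | i <- a] * mon s [seq (i %% n)%N | i <- a].
Proof.
elim: s a => [|x s IH] [|i a] //=; first by rewrite !mon_nil mulr1.
move=> [sa]; rewrite !mon_cons (IH a sa) {1}(divn_eq i n) exprD mulnC exprM.
by ring.
Qed.

(** Divide each exponent by [n]: the remainders use up at most [size s * n] of the degree, so the
    quotients add up to at least [k]. *)
Lemma ideal_exp_spow n k s : (0 < n)%N ->
  ideal_exp (ideal_gen [set` s]) (n * k + size s * n) `<=` ideal_exp (ideal_gen [set` spow n s]) k.
Proof.
move=> n0; have iQ := is_ideal_gen [set` spow n s].
rewrite ideal_exp_gen; apply: ideal_gen_sub; first exact: is_ideal_exp.
move=> _ [a [sa na] <-]; rewrite (mon_spow n sa); apply: idlMr; first exact: is_ideal_exp.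
have sa' : size [seq (i %/ n)%N | i <- a] = size (spow n s) by rewrite !size_map.
have := mon_exp iQ (@ideal_genP A [set` spow n s]) sa'; apply: ideal_exp_le => //.
suff: (sumn a <= n * sumn [seq (i %/ n)%N | i <- a] + size a * n)%N by rewrite na sa; nia.
elim: a {sa na sa'} => //= i a IH; have := divn_eq i n; have := ltn_pmod i n0; nia.
Qed.

Lemma max_primary_spow n s : (0 < n)%N -> max_primary m (ideal_gen [set` s]) ->
  max_primary m (ideal_gen [set` spow n s]).
Proof.
move=> n0 pQ; apply: max_primaryS (max_primary_exp_ideal (n * 1 + size s * n) pQ).
  exact: is_ideal_gen.
exact: (ideal_exp_spow (k := 1)).
Qed.

Lemma coef_comp_affine d (p : {poly rat}) c e : c != 0 -> (size p <= d.+1)%N ->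
  (size (p \Po (c *: 'X + e%:P)) <= d.+1)%N /\
  (p \Po (c *: 'X + e%:P))`_d = c ^+ d * p`_d.
Proof.
move=> c0 sp; set q := c *: 'X + e%:P.
have sq : size q = 2%N.
  by rewrite size_addl size_scale ?size_polyX // size_polyC; case: eqP.
have lq : lead_coef q = c by rewrite lead_coefE sq coefD coefZ coefX coefC /= mulr1 addr0.
split; first by rewrite size_comp_poly2.
have -> : p = \poly_(i < d.+1) p`_i.
  apply/polyP => i; rewrite coef_poly; case: ltnP => // di.
  by rewrite nth_default // (leq_trans sp).
rewrite poly_def raddf_sum /= coef_sum big_ord_recr /= big1 ?add0r => [|i _].
  rewrite comp_polyZ comp_Xn_poly coefZ mulrC; congr (_ * _).
    by rewrite -lq -lead_coef_exp lead_coefE size_exp sq mul1n.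
  by rewrite -poly_def coef_poly ltnSn.
rewrite comp_polyZ comp_Xn_poly coefZ [X in _ * X]nth_default ?mulr0 //.
by apply: leq_trans (size_poly_exp_leq _ _) _; rewrite sq mul1n.
Qed.

(** The k-th power of (x_1^n, ..., x_d^n) and Q^(nk) contain each other up to a bounded shift of the
    exponent, so the top coefficients agree after substituting n k for k. *)
Lemma multiplicity_spow n s : size s = krull_dim A -> (0 < n)%N ->
  max_primary m (ideal_gen [set` s]) ->
  multiplicity (ideal_gen [set` spow n s]) =
  n%:R ^+ krull_dim A * multiplicity (ideal_gen [set` s]).
Proof.
move=> sd n0 pQ; have pQ' := max_primary_spow n0 pQ.
rewrite /multiplicity mulrCA; congr (_ * _).
have [sp [n1 pE]] := hilbert_samuel_polyP pQ; have [sp' [n2 pE']] := hilbert_samuel_polyP pQ'.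
have iQ : is_ideal (ideal_gen [set` s]) := is_ideal_gen _.
have iQ' : is_ideal (ideal_gen [set` spow n s]) := is_ideal_gen _.
set p' := hilbert_samuel_poly _ in sp' pE' *; set p := hilbert_samuel_poly _ in sp pE *.
rewrite size_map sd in sp'; rewrite sd in sp.
have nz : n%:R != 0 :> rat by rewrite pnatr_eq0 -lt0n.
(* At k the polynomials measure the power k+1: the shift [n.-1] makes nk + (n-1) + 1 equal to
   n(k+1), and the second shift adds the loss [krull_dim A * n] of [ideal_exp_spow]. *)
have [s1 c1] := coef_comp_affine (n.-1)%:R nz sp.
have [s2 c2] := coef_comp_affine (n.-1 + krull_dim A * n)%:R nz sp.
have hE k e : (n%:R *: 'X + e%:R%:P).[k%:R] = (n * k + e)%:R :> rat.
  by rewrite hornerD hornerZ hornerX hornerC -natrM -natrD.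
apply/eqP; rewrite eq_le; apply/andP; split.
  rewrite -c2 -subr_ge0 -coefB; apply: (lead_coef_ge0 (n0 := maxn n1 n2)).
    by rewrite (leq_trans (size_polyD _ _)) // geq_max size_polyN s2.
  move=> k; rewrite geq_max => /andP[k1 k2].
  rewrite hornerD hornerN horner_comp hE pE' // pE; last by nia.
  rewrite subr_ge0 ler_nat; apply: colengthS; try exact: is_ideal_exp.
    by apply: (max_primary_finite noeth locm); apply: max_primary_exp_ideal.
  apply: subset_trans (ideal_exp_spow (k := k.+1) (s := s) n0); apply: ideal_exp_le => //.
  by rewrite sd; nia.
rewrite -c1 -subr_ge0 -coefB; apply: (lead_coef_ge0 (n0 := maxn n1 n2)).
  by rewrite (leq_trans (size_polyD _ _)) // geq_max size_polyN s1 sp'.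
move=> k; rewrite geq_max => /andP[k1 k2].
rewrite hornerD hornerN horner_comp hE pE' // pE; last by nia.
rewrite subr_ge0 ler_nat; apply: colengthS; try exact: is_ideal_exp.
  by apply: (max_primary_finite noeth locm); apply: max_primary_exp_ideal.
have -> : (n * k + n.-1).+1 = (n * k.+1)%N by nia.
apply: subset_trans (@ideal_exp_exp _ n k.+1 iQ); apply: ideal_expS_le => //.
  exact: is_ideal_exp.
apply: ideal_gen_sub => [|z /mapP[x xs ->]]; first exact: is_ideal_exp.
by apply: ideal_expX => //; apply: ideal_genP.
Qed.

End HilbertSamuel.

(** * The colon property of parameters *)

Section Families.
Variables (A : comNzRingType) (d : nat).
Implicit Types (x : 'I_d -> A) (P : pred 'I_d) (b : 'I_d -> nat) (I : set A).

Definition lc x P : set A := [set z | exists a : 'I_d -> A, z = \sum_(i | P i) a i * x i].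

Lemma is_ideal_lc x P : is_ideal (lc x P).
Proof.
split=> [|_ _ [a ->] [b ->]|c _ [a ->]].
- by exists (fun=> 0); rewrite big1 // => i _; rewrite mul0r.
- by exists (fun i => a i + b i); rewrite -big_split; apply: eq_bigr => i _; rewrite mulrDl.
- by exists (fun i => c * a i); rewrite mulr_sumr; apply: eq_bigr => i _; rewrite mulrA.
Qed.

Lemma mem_lc x P i : P i -> lc x P (x i).
Proof.
move=> Pi; exists (fun j => (j == i)%:R); rewrite (bigD1 i) //= eqxx mul1r big1 ?addr0 //.
by move=> j /andP[_ /negbTE ->]; rewrite mul0r.
Qed.

Lemma lc_sub x P I : is_ideal I -> (forall i, P i -> I (x i)) -> lc x P `<=` I.
Proof.
by move=> iI PI _ [a ->]; apply: idl_sum => // i Pi; apply: idlMl => //; apply: PI.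
Qed.

Lemma lcS x P P' : (forall i, P i -> P' i) -> lc x P `<=` lc x P'.
Proof.
by move=> PP'; apply: lc_sub => [|i Pi]; [apply: is_ideal_lc|apply: mem_lc; apply: PP'].
Qed.

Lemma lc_subset x y P P' : (forall i, P i -> lc y P' (x i)) -> lc x P `<=` lc y P'.
Proof. exact: lc_sub (is_ideal_lc _ _). Qed.

Lemma eq_lc x y P P' : P =1 P' -> (forall i, P i -> x i = y i) -> lc x P = lc y P'.
Proof.
move=> PP' xy; apply/seteqP; split; apply: lc_subset => i Pi.
  by rewrite xy //; apply: mem_lc; rewrite -PP'.
by rewrite -PP' in Pi; rewrite -xy //; apply: mem_lc.
Qed.

Lemma lcD1 x P i : P i -> lc x P = iaddp (lc x [pred j | P j & j != i]) (x i).
Proof.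
move=> Pi; have iL := is_ideal_lc x [pred j | P j & j != i].
apply/seteqP; split.
  apply: lc_sub => [|j Pj]; first exact: is_ideal_addp.
  case: (eqVneq j i) => [->|ji]; first exact: mem_addp.
  by apply: sub_addp; apply: mem_lc; rewrite /= Pj.
apply: addp_sub; [exact: is_ideal_lc|by apply: lcS => j /andP[]|exact: mem_lc].
Qed.

Definition upd (T : Type) (f : 'I_d -> T) i (v : T) := fun j => if j == i then v else f j.

(** Passes from [f] to [v] one coordinate at a time; applied below to exponents and to the rows of a
    matrix. *)
Lemma upd_all (T : Type) (Phi : ('I_d -> T) -> Prop) (v : 'I_d -> T) :
  (forall f i, Phi f -> Phi (upd f i (v i))) -> forall f, Phi f -> Phi v.
Proof.
move=> step f Pf.
have h (r : seq 'I_d) : Phi (fun j => if j \in r then v j else f j).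
  elim: r => [|i r IH]; first exact: Pf.
  have := step _ i IH; congr (Phi _); apply/funext => j; rewrite /upd inE.
  by case: eqP => [->|].
by have := h (enum 'I_d); congr (Phi _); apply/funext => j; rewrite mem_enum.
Qed.

Definition xpow x b := fun i => x i ^+ b i.

Lemma xpow_xpow x b b' : xpow (xpow x b) b' = xpow x (fun i => b i * b' i)%N.
Proof. by apply/funext => i; rewrite /xpow exprM. Qed.

Lemma xpow1 x : xpow x (fun=> 1%N) = x.
Proof. by apply/funext => i; rewrite /xpow expr1. Qed.

Lemma lc_xpow_le x b b' P : (forall i, P i -> b i <= b' i)%N ->
  lc (xpow x b') P `<=` lc (xpow x b) P.
Proof.
move=> bb'; apply: lc_subset => i Pi.
apply: (idlXn (is_ideal_lc _ _) (bb' i Pi)); exact: (mem_lc (xpow x b)).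
Qed.

Lemma ideal_gen_codom x : ideal_gen [set` codom x] = lc x xpredT.
Proof.
have iL := is_ideal_lc x xpredT; apply/seteqP; split.
  by apply: ideal_gen_sub => // _ /codomP[i ->]; apply: mem_lc.
by apply: lc_sub => [|i _]; [apply: is_ideal_gen|apply: ideal_genP; apply: codom_f].
Qed.

Lemma ideal_gen_nth s : size s = d -> ideal_gen [set` s] = lc (fun i : 'I_d => s`_i) xpredT.
Proof.
move=> sd; have iL := is_ideal_lc (fun i : 'I_d => s`_i) xpredT.
apply/seteqP; split.
  apply: ideal_gen_sub => // z /= zs; rewrite -(nth_index 0 zs).
  have iz : (index z s < d)%N by rewrite -sd index_mem.
  exact: (@mem_lc (fun i : 'I_d => s`_i) xpredT (Ordinal iz)).
apply: lc_sub => [|i _]; first exact: is_ideal_gen.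
by apply: ideal_genP; rewrite /= mem_nth // sd.
Qed.

Lemma codom_xpow x n : codom (xpow x (fun=> n)) = spow n (codom x).
Proof. by rewrite !codomE /spow -[RHS]map_comp. Qed.

End Families.

(** * Colon ideals of parameters in a Buchsbaum ring *)

Section ColonProperty.
Variable A : comNzRingType.
Hypothesis noeth : noetherian A.
Variable m : set A.
Hypothesis locm : local_ring m.
Let im : is_ideal m := is_ideal_max locm.

Lemma max_prime x y : m (x * y) -> m x \/ m y.
Proof.
move=> mxy; have [|nx] := pselect (m x); [by left|right].
have [u u1] := unit_nmax noeth locm nx.
by rewrite -(mul1r y) -u1 -mulrA; apply: idlMl.
Qed.

Lemma max_expP x n : m (x ^+ n) -> m x.
Proof.
elim: n => [/(max_n1 locm)//|n IH]; rewrite exprS => /max_prime[]//.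
Qed.

Section Fixed.
Variable d : nat.
Implicit Types (x : 'I_d -> A) (P : pred 'I_d) (b : 'I_d -> nat).

Definition sop x := max_primary m (lc x xpredT) /\ forall i, m (x i).

Lemma sopP x : sop x <-> radical (lc x xpredT) = m.
Proof.
have iL := is_ideal_lc x xpredT; split=> [[[_ mx] xm]|mE].
  apply/seteqP; split=> [y [n] /(lc_sub im (fun i _ => xm i))|]; first exact: max_expP.
  by move=> y /mx.
split; first by split=> // y; rewrite -mE.
by move=> i; rewrite -mE; exists 1%N; apply: mem_lc.
Qed.

Lemma sop_xpow x b : (forall i, (0 < b i)%N) -> sop x -> sop (xpow x b).
Proof.
move=> b0 [px xm]; split; last first.
  by move=> i; rewrite /xpow -(prednK (b0 i)) exprS; apply: idlMr.
pose n := (\sum_i b i).+1.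
have pn : max_primary m (lc (xpow x (fun=> n)) xpredT).
  by rewrite -ideal_gen_codom codom_xpow; apply: max_primary_spow => //; rewrite ideal_gen_codom.
apply: max_primaryS pn; first exact: is_ideal_lc.
by apply: lc_xpow_le => i _; rewrite /n (bigD1 i) //=; lia.
Qed.

Definition colon_property x := forall P i, ~~ P i -> forall u z,
  lc x P (u * x i) -> m z -> lc x P (u * z).

Lemma sop_finite x : sop x -> finite_colength (lc x xpredT).
Proof. by case=> px _; apply: (max_primary_finite noeth locm px). Qed.

(** The colon of (c, y^(n+1)) by y^n is (c : y^n) + (y). *)
Lemma colength_powS (c : set A) y n : is_ideal c -> finite_colength (iaddp c (y ^+ n.+1)) ->
  colength (iaddp c (y ^+ n.+1)) =
  (colength (iaddp c (y ^+ n)) + colength (iaddp (icolp c (y ^+ n)) y))%N.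
Proof.
move=> ic fc; have ia := is_ideal_addp (y ^+ n.+1) ic.
rewrite (colength_addp_colp (y := y ^+ n) ia); last 2 first.
- exact: finite_colengthS (@sub_addp _ _ _) fc.
- exact: finite_colengthS (sub_colp _ ia) fc.
congr addn; congr colength; apply/seteqP; split.
- have ian := is_ideal_addp (y ^+ n) ic.
  apply: addp_sub => //; last exact: mem_addp.
  apply: addp_sub => //; first exact: sub_addp.
  by rewrite exprS; apply: idlMl => //; apply: mem_addp.
- by apply: addpS; apply: sub_addp.
- move=> u [a ca]; exists a; rewrite /icolp /=.
  by have -> : (u - a * y) * y ^+ n = u * y ^+ n - a * y ^+ n.+1 by rewrite exprS; ring.
- move=> u [a ca]; exists a.
  by have <- : (u - a * y) * y ^+ n = u * y ^+ n - a * y ^+ n.+1 by rewrite exprS; ring.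
Qed.

Lemma colength_pow_le (c : set A) y n : is_ideal c -> (forall k, finite_colength (iaddp c (y ^+ k))) ->
  (colength (iaddp c (y ^+ n)) <= n * colength (iaddp c y))%N.
Proof.
move=> ic fc; elim: n => [|n IH].
  rewrite expr0 (_ : iaddp c 1 = setT) ?colengthT //.
  by apply: idlT; [apply: is_ideal_addp|apply: mem_addp].
rewrite colength_powS // mulSn addnC leq_add // colengthS //.
- exact: is_ideal_addp.
- by apply: is_ideal_addp; apply: is_ideal_colp.
- by have := fc 1%N; rewrite expr1.
- by apply: addpS; apply: sub_colp.
Qed.

Lemma lc_upd x i v : lc (upd x i v) xpredT = iaddp (lc x (predC1 i)) v.
Proof.
rewrite (@lcD1 _ _ _ _ i) // /upd eqxx; congr iaddp.
by apply: eq_lc => j //= /negbTE ->.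
Qed.

Lemma lc_updN x i v P : ~~ P i -> lc (upd x i v) P = lc x P.
Proof.
by move=> Pi; apply: eq_lc => // j Pj; rewrite /upd; case: eqP => // ji; rewrite -ji Pj in Pi.
Qed.

Lemma lc_full x i : lc x xpredT = iaddp (lc x (predC1 i)) (x i).
Proof. by rewrite (@lcD1 _ _ _ _ i). Qed.

Lemma sop_updX x i n : (0 < n)%N -> sop x -> sop (upd x i (x i ^+ n)).
Proof.
move=> n0 sx; have := @sop_xpow x (upd (fun=> 1%N) i n) _ sx.
have -> : xpow x (upd (fun=> 1%N) i n) = upd x i (x i ^+ n).
  by apply/funext => j; rewrite /xpow /upd; case: eqP => [->|_]; rewrite ?expr1.
by apply=> j; rewrite /upd; case: eqP.
Qed.

Lemma sop_addpX_finite x i n : sop x -> finite_colength (iaddp (lc x (predC1 i)) (x i ^+ n)).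
Proof.
move=> sx; case: n => [|n]; last first.
  by rewrite -lc_upd; apply: sop_finite; apply: sop_updX.
apply: finite_colengthS (sop_finite sx); rewrite (idlT (I := iaddp _ _)) //.
  by apply: is_ideal_addp; apply: is_ideal_lc.
by apply: mem_addp; apply: is_ideal_lc.
Qed.

Lemma colength_upd_le x b i n : sop x -> (forall j, (0 < b j)%N) ->
  (colength (lc (xpow x (upd b i (b i * n)%N)) xpredT) <= n * colength (lc (xpow x b) xpredT))%N.
Proof.
move=> sx b0; have sb := sop_xpow b0 sx.
have -> : xpow x (upd b i (b i * n)%N) = upd (xpow x b) i (xpow x b i ^+ n).
  by apply/funext => j; rewrite /xpow /upd; case: eqP => [->|//]; rewrite exprM.
rewrite lc_upd (lc_full (xpow x b) i); apply: colength_pow_le.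
- exact: is_ideal_lc.
- by move=> k; apply: sop_addpX_finite.
Qed.

Lemma colength_scale_le x b (r : seq 'I_d) n : sop x -> (forall j, (0 < b j)%N) -> (0 < n)%N ->
  uniq r ->
  (colength (lc (xpow x (fun j => if j \in r then b j * n else b j)%N) xpredT) <=
   n ^ size r * colength (lc (xpow x b) xpredT))%N.
Proof.
move=> sx b0 n0; elim: r => [|i r IH] /=; first by rewrite mul1n.
move=> /andP[ir /IH{}IH]; rewrite expnS -mulnA.
apply: leq_trans (leq_mul (leqnn n) IH).
set b' := (fun j => if j \in r then _ else _).
have -> : (fun j => if j \in i :: r then b j * n else b j)%N = upd b' i (b' i * n)%N.
  apply/funext => j; rewrite /upd inE /b' (negbTE ir); by case: eqP => [->|].
apply: colength_upd_le => // j; rewrite /b'; case: ifP => // _.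
by rewrite muln_gt0 b0.
Qed.

Hypothesis dE : d = krull_dim A.
Hypothesis d0 : (0 < d)%N.
Hypothesis buchs : forall x y, sop x -> sop y ->
  (colength (lc x xpredT))%:R - multiplicity (lc x xpredT) =
  (colength (lc y xpredT))%:R - multiplicity (lc y xpredT).

Lemma multiplicity_xpow x n : sop x -> (0 < n)%N ->
  multiplicity (lc (xpow x (fun=> n)) xpredT) = n%:R ^+ d * multiplicity (lc x xpredT).
Proof.
move=> [px _] n0; rewrite -!ideal_gen_codom codom_xpow [n%:R ^+ d](congr1 _ dE).
apply: (multiplicity_spow noeth locm) => //; last by rewrite ideal_gen_codom.
by rewrite size_codom card_ord.
Qed.

Lemma rat_archimedean_exp (a c : rat) :
  (forall n, (0 < n)%N -> n%:R ^+ d * a <= c) -> a <= 0.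
Proof.
move=> h; rewrite -oppr_ge0; apply: (rat_archimedean (n0 := 1) (y := `|c|)) => n n0.
rewrite mulNr addrC subr_ge0 leNgt; apply/negP => cn.
have ap : 0 < a.
  have : 0 < a * n%:R by apply: le_lt_trans cn.
  by rewrite pmulr_lgt0 // ltr0n.
have := le_lt_trans (le_trans (h n n0) (ler_norm c)) cn.
rewrite mulrC ltr_pM2l //; apply/negP; rewrite -leNgt -natrX ler_nat.
by rewrite -{1}(expn1 n) leq_pexp2l.
Qed.

(* Compare the colengths of the parameters x_j^k, of these with x_i^(kn) instead of x_i^k, and of
   x_j^(kn): they are C + k^d e, C + k^d e' and C + (kn)^d e, and replacing one x_j^a by x_j^(an)
   multiplies a colength by at most n. Let k go to infinity. *)
Lemma multiplicity_updX x i n : sop x -> (0 < n)%N ->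
  multiplicity (lc (upd x i (x i ^+ n)) xpredT) = n%:R * multiplicity (lc x xpredT).
Proof.
move=> sx n0; set e := multiplicity (lc x xpredT).
have sx1 := sop_updX i n0 sx; set x1 := upd x i _ in sx1 *; set e1 := multiplicity _.
pose C := (colength (lc x xpredT))%:R - e.
have CE y : sop y -> (colength (lc y xpredT))%:R = C + multiplicity (lc y xpredT).
  by move=> sy; rewrite /C (buchs sx sy) subrK.
have FE k : (0 < k)%N -> (colength (lc (xpow x (fun=> k)) xpredT))%:R = C + k%:R ^+ d * e.
  by move=> k0; rewrite CE ?multiplicity_xpow //; apply: sop_xpow.
have x1E k : xpow x1 (fun=> k) = xpow x (upd (fun=> k) i (k * n)%N).
  by apply/funext => j; rewrite /xpow /x1 /upd; case: eqP => // ->; rewrite -exprM mulnC.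
have F1E k : (0 < k)%N -> (colength (lc (xpow x (upd (fun=> k) i (k * n)%N)) xpredT))%:R =
    C + k%:R ^+ d * e1.
  by move=> k0; rewrite -x1E CE ?multiplicity_xpow //; apply: sop_xpow.
have n0' : 0 < n%:R :> rat by rewrite ltr0n.
apply/eqP; rewrite eq_le; apply/andP; split; rewrite -subr_le0.
  apply: (rat_archimedean_exp (c := n%:R * C - C)) => k k0.
  have := @colength_upd_le x (fun=> k) i n sx (fun=> k0).
  rewrite -(ler_nat rat) natrM F1E // FE // => h.
  rewrite -subr_ge0; move: h; rewrite -subr_ge0; congr (0 <= _); ring.
have np : 0 < n%:R ^+ d.-1 :> rat by rewrite exprn_gt0.
rewrite -(pmulr_rle0 _ np).
apply: (rat_archimedean_exp (c := n%:R ^+ d.-1 * C - C)) => k k0.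
pose b := upd (fun=> k) i (k * n)%N.
have b0 j : (0 < b j)%N by rewrite /b /upd; case: eqP => // _; rewrite muln_gt0 k0.
have := @colength_scale_le x b (enum (predC1 i)) n sx b0 n0 (enum_uniq _).
have -> : (fun j => if j \in enum (predC1 i) then b j * n else b j)%N = (fun=> k * n)%N.
  by apply/funext => j; rewrite mem_enum inE /= /b /upd; case: eqP.
rewrite -cardE cardC1 card_ord -(ler_nat rat) natrM F1E // FE ?muln_gt0 ?k0 // natrX natrM exprMn => h.
rewrite -subr_ge0; move: h; rewrite -subr_ge0; congr (0 <= _).
have -> : n%:R ^+ d = n%:R * n%:R ^+ d.-1 :> rat by rewrite -exprS prednK.
ring.
Qed.

(** By [multiplicity_updX] the colength of (c, y^k) is affine in k >= 1, so the increasing ideals (c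
    : y^k) + (y), k >= 1, have the same colength and are equal. The stable value N of c : y^k then
    lies in (c : y) + y N, hence in c : y by Nakayama. *)
Lemma colp_exp_stable x i n : sop x ->
  icolp (lc x (predC1 i)) (x i ^+ n.+1) `<=` icolp (lc x (predC1 i)) (x i).
Proof.
move=> sx; set c := lc x _; set y := x i.
have ic : is_ideal c by apply: is_ideal_lc.
have fc k : finite_colength (iaddp c (y ^+ k)) by apply: sop_addpX_finite.
have icl k := is_ideal_colp (y ^+ k) ic.
have ia k := is_ideal_addp y (icl k).
pose C := (colength (lc x xpredT))%:R - multiplicity (lc x xpredT).
have FE k : (0 < k)%N -> (colength (iaddp c (y ^+ k)))%:R = C + k%:R * multiplicity (lc x xpredT).
  move=> k0; have sk := sop_updX i k0 sx.
  by rewrite -(multiplicity_updX i sx k0) /C (buchs sx sk) subrK lc_upd.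
have GE k : (colength (iaddp (icolp c (y ^+ k.+1)) y))%:R = multiplicity (lc x xpredT).
  have := congr1 (fun n => n%:R : rat) (colength_powS (n := k.+1) ic (fc k.+2)).
  rewrite natrD !FE // => h; apply/(addrI (C + k.+1%:R * multiplicity (lc x xpredT))).
  by rewrite -h -[k.+2]addn1 natrD; ring.
have cS k j : (k <= j)%N -> icolp c (y ^+ k) `<=` icolp c (y ^+ j).
  by move=> /subnK <- u; rewrite /icolp /= exprD mulrCA; apply: idlMl.
have GS k : iaddp (icolp c (y ^+ k.+1)) y = iaddp (icolp c y) y.
  apply: colength_eq.
  - by have := ia 1%N; rewrite expr1.
  - exact: ia.
  - by have := fc 1%N; rewrite expr1; apply: finite_colengthS; apply: addpS; apply: sub_colp.
  - by apply: addpS; have := cS 1%N k.+1 isT; rewrite expr1.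
  - by apply/eqP; rewrite -(eqr_nat rat) GE; have := GE 0%N; rewrite expr1 => ->.
have [n0 st] : exists n0, forall n, (n0 <= n)%N -> icolp c (y ^+ n) = icolp c (y ^+ n0).
  by apply: (noetherian_chain noeth (I := fun n => icolp c (y ^+ n))) => // k; apply: cS.
have NE k : icolp c (y ^+ (n0 + k)) = icolp c (y ^+ n0) by apply: st; apply: leq_addr.
have my : m y by case: sx => _; apply.
apply: (subset_trans (cS n.+1 (n0 + n.+1)%N (leq_addl _ _))).
apply: (nakayama1 noeth locm (icl _) (is_ideal_colp y ic) my) => u; rewrite addnS => cu.
have : iaddp (icolp c y) y u by rewrite -(GS (n0 + n)%N); apply: sub_addp.
move=> [w cw]; exists w; last by rewrite mulrC.
have cyS : icolp c y `<=` icolp c (y ^+ (n0 + n).+1).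
  by have := cS 1%N (n0 + n).+1 isT; rewrite expr1.
have : icolp c (y ^+ (n0 + n.+2)) w.
  by have := idlBl (icl _) (cyS _ cw) cu; rewrite /icolp /= -mulrA -exprS !addnS.
by rewrite -addnS !NE.
Qed.

(* principal_ideal_power makes z + x_i^(k+1) a parameter modulo the other x_j, so it may replace x_i. *)
Lemma colon_property_last x i u z : sop x -> lc x (predC1 i) (u * x i) -> m z ->
  lc x (predC1 i) (u * z).
Proof.
move=> sx; have [px xm] := sx; set c := lc x _; set y := x i => cu mz.
have ic : is_ideal c by apply: is_ideal_lc.
have [n [k]] := principal_ideal_power noeth locm ic (xm i) (eq_ind _ _ px _ (lc_full x i)) mz.
rewrite -/y => -[b hb].
(* Modulo [c] and [z'], z is -y^(k+1), and the relation y^k z^n = b z^(n+1) becomes (1 + b y) y^(k +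
   (k+1)n) = 0 with a unit factor; so [J] contains a power of [y]. *)
pose z' := z + y ^+ k.+1.
have mz' : m z' by apply: idlD => //; rewrite exprS; apply: idlMr => //; apply: xm.
pose J := iaddp c z'; have iJ : is_ideal J by apply: is_ideal_addp.
have Jy : J (y ^+ (k + k.+1 * n)).
  have mby : m (- (b * y)) by apply: idlN => //; apply: idlMl => //; apply: xm.
  apply: (colp_unit noeth locm iJ mby).
  have JzX j : J (z ^+ j - (- y ^+ k.+1) ^+ j).
    by rewrite subrXX opprK; apply: (idlMr _ iJ (mem_addp z' ic)).
  have h1 : J (y ^+ k * z ^+ n - b * z ^+ n.+1) by apply: sub_addp.
  have h2 := idlMl (y ^+ k) iJ (JzX n); have h3 := idlMl b iJ (JzX n.+1).
  have h4 := idlD iJ (idlB iJ h1 h2) h3.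
  have h5 := idlMl ((-1) ^+ n) iJ h4; move: h5; congr J.
  have -> : - y ^+ k.+1 = (-1) * y ^+ k.+1 by ring.
  rewrite !exprMn -!exprM mulnS (exprD y k) (exprD y k.+1) !exprS.
  have s1 : (-1) ^+ n * (-1) ^+ n = 1 :> A by rewrite -exprD -signr_odd oddD addbb expr0.
  transitivity (((-1) ^+ n * (-1) ^+ n) *
    ((1 + b * y) * (y ^+ k * y ^+ (k.+1 * n)))); last by rewrite s1 mul1r opprK.
  ring.
have pJ : max_primary m J.
  have [pk _] := sop_updX i (ltn0Sn (k + k.+1 * n)) sx.
  rewrite lc_upd in pk; apply: max_primaryS pk => //.
  apply: addp_sub => //; first exact: sub_addp.
  by rewrite exprS; apply: idlMl.
have sx' : sop (upd x i z').
  by split; [rewrite lc_upd|move=> j; rewrite /upd; case: eqP].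
have lcE : lc (upd x i z') (predC1 i) = c by apply: lc_updN; rewrite /= eqxx.
have uE : upd x i z' i = z' by rewrite /upd eqxx.
(* Some z'^j lies in c + (y), and u y is in [c], so u z'^(j+1) is in [c]. Stability for the new
   parameter gives u z' in [c], from which u y^(k+1) is subtracted. *)
have st n0 := @colp_exp_stable _ i n0 sx'; rewrite lcE uE in st.
have [j] : exists j, iaddp c y (z' ^+ j).
  by case: px => _ /(_ _ mz'); rewrite (lc_full x i).
move=> [a ca].
have : icolp c (z' ^+ j.+1) u.
  rewrite /icolp /=.
  have -> : u * z' ^+ j.+1 = u * z' * (z' ^+ j - a * y) + a * z' * (u * y) by rewrite exprS; ring.
  by apply: idlD => //; apply: idlMl.
move=> /st; rewrite /icolp /= /z' mulrDr => h.
have h2 : c (u * y ^+ k.+1) by rewrite exprS mulrA; apply: idlMr.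
by have := idlB ic h h2; rewrite addrK.
Qed.

(** Induction on the number of indices other than [i] outside [P]. One such [r] is added to [P] with
    x_r replaced by an arbitrary power, and Krull's intersection theorem removes these powers
    again. *)
Lemma sop_colon_property x : sop x -> colon_property x.
Proof.
move=> sx P i; move En : #|[pred j | (j != i) && ~~ P j]| => n.
elim: n x P En sx => [|n IH] x P En sx Pi u z cu mz.
  have PE : P =1 predC1 i.
    move=> j /=; move/eqP: En; rewrite -leqn0 leqNgt => /negP En.
    case: eqVneq => [->|ji]; first exact: negbTE.
    apply: contraT => /negbTE Pj; exfalso; apply: En; apply/card_gt0P; exists j.
    by rewrite inE /= ji; case: (P j) Pj.
  rewrite (eq_lc PE (fun _ _ => erefl)) in cu *.
  exact: colon_property_last cu mz.
have [r] : exists r, r \in [pred j | (j != i) && ~~ P j] by apply/card_gt0P; rewrite En.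
rewrite inE /= => /andP[ri Pr].
have ic := is_ideal_lc x P.
apply: (krull_intersection1 noeth locm ic (r := x r)); first by case: sx => _; apply.
move=> [|k]; first by rewrite (idlT (is_ideal_addp _ ic)) //; apply: mem_addp.
pose P' := [pred j | (j == r) || P j].
have sk := @sop_updX x r k.+1 isT sx.
have PE : lc (upd x r (x r ^+ k.+1)) P' = iaddp (lc x P) (x r ^+ k.+1).
  rewrite (@lcD1 _ _ _ _ r) /= ?eqxx // {2}/upd eqxx; congr iaddp.
  apply: eq_lc => j /=; first by case: eqVneq => [->|]; rewrite ?andbF ?(negbTE Pr) ?andbT.
  by rewrite /upd => /andP[_ /negbTE ->].
rewrite -PE; apply: IH => //.
- move: En; rewrite (cardD1 r) inE /= ri Pr add1n => -[<-].
  by apply: eq_card => j; rewrite !inE /= negb_or; case: (j == r); case: (j == i).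
- by rewrite /= negb_or eq_sym ri.
- by rewrite {2}/upd eq_sym (negbTE ri) PE; apply: sub_addp.
Qed.

End Fixed.
End ColonProperty.

(** * Limit closure and socle *)

Section LimitClosure.
Variable A : comNzRingType.
Hypothesis noeth : noetherian A.
Variable m : set A.
Hypothesis locm : local_ring m.
Let im : is_ideal m := is_ideal_max locm.
Variable d : nat.
Implicit Types (x q t : 'I_d -> A) (P : pred 'I_d) (b c e : 'I_d -> nat).
Hypothesis CP : forall x, sop m x -> colon_property m x.

Definition mp x e : A := \prod_i x i ^+ e i.

Lemma mpD x e c : mp x (fun i => e i + c i)%N = mp x e * mp x c.
Proof. by rewrite /mp -big_split; apply: eq_bigr => i _; rewrite exprD. Qed.

Lemma mpM x n c : mp (xpow x (fun=> n)) c = mp x (fun i => n * c i)%N.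
Proof. by apply: eq_bigr => i _; rewrite /xpow exprM. Qed.

Lemma mp_upd x e i n : mp x (upd e i n) = mp x (upd e i 0%N) * x i ^+ n.
Proof.
rewrite /mp (bigD1 i) //= (bigD1 (F := fun j => x j ^+ upd e i 0%N j) i) //=.
rewrite /upd eqxx expr0 mul1r mulrC; congr (_ * _).
by apply: eq_bigr => j /negbTE ->.
Qed.

Lemma upd_id (T : Type) (f : 'I_d -> T) i : upd f i (f i) = f.
Proof. by apply/funext => j; rewrite /upd; case: eqP => [->|]. Qed.

Lemma xpow_upd x b i n : xpow x (upd b i n) = upd (xpow x b) i (x i ^+ n).
Proof. by apply/funext => j; rewrite /xpow /upd; case: eqP => [->|]. Qed.

Lemma lc_mul x b c P z : lc (xpow x b) P z ->
  lc (xpow x (fun i => b i + c i)%N) P (z * mp x c).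
Proof.
have iL := is_ideal_lc (xpow x (fun i => b i + c i)%N) P.
suff: lc (xpow x b) P `<=` icolp (lc (xpow x (fun i => b i + c i)%N) P) (mp x c) by apply.
apply: lc_sub => [|i Pi]; first exact: is_ideal_colp.
rewrite /icolp /= /mp (bigD1 i) //= mulrA -exprD; apply: idlMr => //.
exact: (mem_lc (xpow x (fun i => b i + c i)%N)).
Qed.

(** Modulo the other powers, (u - w x_i^n) x_i^a vanishes for some w; the colon property of the
    system with x_i^a in place [i] allows x_i^a to be replaced by x_i. *)
Lemma peel x b i n a u : sop m x -> (forall j, (0 < b j)%N) -> (0 < a)%N ->
  lc (xpow x (upd b i (n + a)%N)) xpredT (u * x i ^+ a) ->
  lc (xpow x (upd b i n.+1)) xpredT (u * x i).
Proof.
move=> sx b0 a0; rewrite !xpow_upd !lc_upd => -[w cw]; exists w.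
set c := lc _ _ in cw *.
have sa : sop m (xpow x (upd b i a)).
  by apply: (sop_xpow locm) => // j; rewrite /upd; case: eqP.
have cE : lc (xpow x (upd b i a)) (predC1 i) = c by rewrite xpow_upd lc_updN //= eqxx.
have := CP sa (P := predC1 i) (i := i); rewrite /= eqxx => /(_ isT (u - w * x i ^+ n) (x i)).
rewrite cE xpow_upd {1}/upd eqxx.
have -> : (u - w * x i ^+ n) * x i ^+ a = u * x i ^+ a - w * x i ^+ (n + a).
  by rewrite exprD; ring.
have -> : (u - w * x i ^+ n) * x i = u * x i - w * x i ^+ n.+1 by rewrite exprS; ring.
by apply => //; case: sx => _; apply.
Qed.

Lemma monomial_peel x n a u : sop m x -> (forall i, (0 < n i + a i)%N) ->
  lc (xpow x (fun i => n i + a i)%N) xpredT (u * mp x a) ->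
  lc (xpow x (fun i => n i + (0 < a i))%N) xpredT (u * mp x (fun i => (0 < a i)%N : nat)).
Proof.
move=> sx na0 ua.
pose v i : nat := (0 < a i)%N.
pose Phi c := (forall i, (0 < c i)%N = (0 < a i)%N) /\
  lc (xpow x (fun i => n i + c i)%N) xpredT (u * mp x c).
suff [] : Phi v by [].
apply: (@upd_all _ _ Phi v _ a) => // c i [ca uc].
have [ai0|ai0] := posnP (a i).
  have ci0 : c i = 0%N by move: (ca i); rewrite ai0; case: (c i).
  have -> : upd c i (v i) = c by rewrite (_ : v i = c i) ?upd_id // /v ai0 ci0.
  by split.
have vi : v i = 1%N by rewrite /v ai0.
split=> [j|]; first by rewrite /upd; case: eqP => [->|//]; rewrite vi ai0.
rewrite mp_upd mulrA vi expr1.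
have -> : (fun j => n j + upd c i 1%N j)%N = upd (fun j => n j + c j)%N i (n i).+1.
  by apply/funext => j; rewrite /upd; case: eqP => [->|//]; rewrite addn1.
apply: (@peel _ _ _ _ (c i)) => //.
- by move=> j; have := na0 j; have := ca j; case: (c j); case: (a j); lia.
- by rewrite ca.
move: uc; rewrite -{2}(upd_id c i) mp_upd mulrA; congr (lc (xpow x _) _ _).
by rewrite (upd_id (fun j => n j + c j)%N i).
Qed.

(* The limit closure, the u with u (x_1 ... x_d)^n in (x_1^(n+1), ..., x_d^(n+1)) for some n; under
   the colon property n = 1 suffices (Lam_intro). *)
Definition Lam x : set A := icolp (lc (xpow x (fun=> 2%N)) xpredT) (mp x (fun=> 1%N)).

Lemma is_ideal_Lam x : is_ideal (Lam x).
Proof. by apply: is_ideal_colp; apply: is_ideal_lc. Qed.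

Lemma lc_Lam x : lc x xpredT `<=` Lam x.
Proof.
move=> u; rewrite -{1}(xpow1 x) => /(lc_mul (fun=> 1%N)).
by rewrite /Lam /icolp /=; congr (lc (xpow x _) _ _).
Qed.

Lemma Lam_intro x n a u : sop m x -> (0 < n)%N ->
  lc (xpow x (fun=> n + a)%N) xpredT (u * mp x (fun=> a)) -> Lam (xpow x (fun=> n)) u.
Proof.
(* Since [a] may be 0, a factor x_1...x_d is inserted to make all exponents positive before they are
   peeled down to 1. *)
move=> sx n0 /(lc_mul (fun=> 1%N)); rewrite -mulrA -mpD => ua.
have h := @monomial_peel x (fun=> n) (fun=> a.+1) u sx (fun i => ltn_addr _ n0).
have {}ua : lc (xpow x (fun=> n + a.+1)%N) xpredT (u * mp x (fun=> a.+1)).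
  move: ua; have -> : (fun=> n + a + 1)%N = (fun=> n + a.+1)%N :> ('I_d -> nat).
    by apply/funext => i; lia.
  by have -> : (fun=> a + 1)%N = (fun=> a.+1)%N :> ('I_d -> nat) by apply/funext => i; lia.
have := lc_mul (fun=> n.-1) (h ua); rewrite -mulrA -mpD /Lam /icolp /= xpow_xpow mpM.
have -> : (fun=> n + 1 + n.-1)%N = (fun=> n * 2)%N :> ('I_d -> nat) by apply/funext => i; lia.
by have -> : (fun=> 1 + n.-1)%N = (fun=> n * 1)%N :> ('I_d -> nat) by apply/funext => i; lia.
Qed.

Lemma Lam_elim x n u : sop m x -> (0 < n)%N -> Lam (xpow x (fun=> n)) u ->
  lc (xpow x (fun=> n.+1)) xpredT (u * mp x (fun=> 1%N)).
Proof.
move=> sx n0; rewrite /Lam /icolp /= xpow_xpow mpM => h.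
have h' := @monomial_peel x (fun=> n) (fun=> n) u sx (fun i => ltn_addr _ n0).
rewrite n0 addn1 in h'; apply: h'; move: h; rewrite muln1.
by have -> : (fun=> n + n)%N = (fun=> n * 2)%N :> ('I_d -> nat) by apply/funext => i; lia.
Qed.

(** Injectivity of the transition maps in the direct system whose limit is the top local cohomology
    module. *)
Lemma Lam_mul_intro x n a u : sop m x -> (0 < n)%N ->
  Lam (xpow x (fun=> n + a)%N) (u * mp x (fun=> a)) -> Lam (xpow x (fun=> n)) u.
Proof.
move=> sx n0; rewrite /Lam /icolp /= xpow_xpow mpM -mulrA -mpD => h.
apply: (Lam_intro (a := (a + (n + a) * 1)%N)) => //.
move: h; congr (lc (xpow x _) _ _); apply/funext => i; lia.
Qed.

Lemma Lam_colon1 x i u : lc x (predC1 i) (u * x i) -> Lam x u.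
Proof.
move=> h; have h2 : lc (xpow x (fun=> 1%N)) (predC1 i) (u * x i) by rewrite xpow1.
have E : x i * mp x (upd (fun=> 1%N) i 0%N) = mp x (fun=> 1%N).
  by rewrite -[in RHS](upd_id (fun=> 1%N) i) [RHS]mp_upd expr1 mulrC.
have := lc_mul (upd (fun=> 1%N) i 0%N) h2; rewrite -mulrA E.
rewrite /Lam /icolp /=; apply: lc_subset => j /= ji.
rewrite /xpow /upd (negbTE ji) //.
exact: (@mem_lc _ _ (xpow x (fun=> 2%N)) xpredT j).
Qed.

(** The index [i] outside [P] provides a test element. Modulo the x_j with j in [P], u x_i = w
    x_k^2; the colon property puts w x_k in the ideal generated by x_i, and w x_k = v x_i defines
    the quotient [v] of [u] by x_k. *)
Lemma colon_square x P i k u : sop m x -> i != k -> ~~ P i -> ~~ P k ->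
  (forall z, m z -> iaddp (lc x P) (x k ^+ 2) (u * z)) ->
  exists2 v, (forall z, m z -> iaddp (lc x P) (x k) (v * z)) &
             (forall z, m z -> lc x P ((u - x k * v) * z)).
Proof.
move=> sx ik Pi Pk hu; have [_ xm] := sx; have iL := is_ideal_lc x P.
have addE j y : ~~ P j -> lc (upd x j y) [pred l | (l == j) || P l] = iaddp (lc x P) y.
  move=> Pj; rewrite (@lcD1 _ _ _ _ j) /= ?eqxx // {2}/upd eqxx; congr iaddp.
  apply: eq_lc => l /=; first by case: eqVneq => [->|]; rewrite ?andbF ?(negbTE Pj) ?andbT.
  by rewrite /upd => /andP[_ /negbTE ->].
have [w hw] := hu _ (xm i).
have sk2 : sop m (upd x k (x k ^+ 2)) by apply: (sop_updX locm).
have [v hv] : iaddp (lc x P) (x i) (w * x k).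
  have := CP sk2 (P := [pred l | (l == i) || P l]) (i := k).
  rewrite /= negb_or eq_sym ik Pk => /(_ isT w (x k)).
  have -> : lc (upd x k (x k ^+ 2)) [pred l | (l == i) || P l] = iaddp (lc x P) (x i).
    by rewrite lc_updN ?(addE i (x i)) -?(addE i (x i)) ?upd_id //= negb_or eq_sym ik Pk.
  rewrite {1}/upd eqxx; apply => //.
  exists u; have -> : w * x k ^+ 2 - u * x i = - (u * x i - w * x k ^+ 2) by ring.
  exact: idlN.
exists v => z mz.
  have := CP sx (P := [pred l | (l == k) || P l]) (i := i).
  rewrite /= negb_or ik Pi => /(_ isT v z).
  have -> : lc x [pred l | (l == k) || P l] = iaddp (lc x P) (x k).
    by rewrite -(addE k (x k)) ?upd_id.
  apply => //; exists w; have -> : v * x i - w * x k = - (w * x k - v * x i) by ring.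
  exact: idlN.
apply: (CP sx Pi) => //.
have -> : (u - x k * v) * x i = (u * x i - w * x k ^+ 2) + x k * (w * x k - v * x i) by ring.
by apply: idlD => //; apply: idlMl.
Qed.

(** [Psi k] is a decomposition valid once the first [k] squares have been lowered to first powers;
    [Psi d] writes [u] as an element of Q plus elements of (q_j, j <> i) : m. Passing from [k] to
    k+1 divides by q_k, with [colon_square] applied to the summands already present. *)
Lemma Lam_sub_colon q u z : sop m q -> Lam q u -> m z -> lc q xpredT (u * z).
Proof.
move=> sq hu mz.
pose b k (i : 'I_d) := if (i < k)%N then 1%N else 2%N.
have b0 k i : (0 < b k i)%N by rewrite /b; case: ifP.
have sb k : sop m (xpow q (b k)) := sop_xpow locm (b0 k) sq.
pose Psi k := exists w (v : 'I_d -> A), [/\ lc (xpow q (b k)) xpredT w,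
    (forall i : 'I_d, (i < k)%N -> forall z, m z -> lc (xpow q (b k)) (predC1 i) (v i * z)) &
    u * mp q (fun i => (k <= i)%N : nat) = w + \sum_(i : 'I_d | (i < k)%N) v i].
have iL := is_ideal_lc q xpredT.
suff /(_ d (leqnn d)) [w [v [hw hv uE]]] : forall k, (k <= d)%N -> Psi k.
  have bE : xpow q (b d) = q by apply/funext => i; rewrite /xpow /b ltn_ord expr1.
  have uE' : u = w + \sum_(i : 'I_d | (i < d)%N) v i.
    rewrite -uE /mp big1 ?mulr1 // => i _.
    by rewrite leqNgt ltn_ord.
  rewrite uE' mulrDl; apply: idlD => //; first by apply: idlMr => //; move: hw; rewrite bE.
  rewrite mulr_suml; apply: idl_sum => // i id; have := hv i id z mz; rewrite bE.
  exact: lcS.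
elim=> [_|k IH kd].
  exists (u * mp q (fun=> 1%N)), (fun=> 0); split=> //.
  by rewrite big_pred0 ?addr0.
have [w [v [hw hv uE]]] := IH (ltnW kd).
pose i0 := Ordinal kd; set p := q i0.
have bS (P : pred 'I_d) : ~~ P i0 -> lc (xpow q (b k)) P = lc (xpow q (b k.+1)) P.
  move=> Pi; apply: eq_lc => // j Pj; rewrite /xpow /b ltnS [in RHS]leq_eqVlt.
  case: eqP => //= jk; have ji0 : j = i0 by apply: val_inj.
  by rewrite -ji0 Pj in Pi.
have bi : xpow q (b k) i0 = p ^+ 2 by rewrite /xpow /b ltnn.
have bi1 : xpow q (b k.+1) i0 = p by rewrite /xpow /b ltnSn expr1.
pose Pc (i : 'I_d) := [pred j | (j != i) && (j != i0)].
have G (i : 'I_d) : exists v', (i < k)%N ->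
    (forall z, m z -> lc (xpow q (b k.+1)) (predC1 i) (v' * z)) /\
    (forall z, m z -> lc (xpow q (b k)) (Pc i) ((v i - p * v') * z)).
  have [ik|ik] := boolP (i < k)%N; last by exists 0.
  have ii0 : i != i0 by apply: contraTneq ik => ->; rewrite ltnn.
  have Pi0 : ~~ Pc i i0 by rewrite /= eqxx andbF.
  have Pii : ~~ Pc i i by rewrite /= eqxx.
  have E1 : lc (xpow q (b k)) (predC1 i) = iaddp (lc (xpow q (b k.+1)) (Pc i)) (p ^+ 2).
    by rewrite (@lcD1 _ _ _ _ i0) /= 1?eq_sym // bi; congr iaddp; rewrite -bS.
  have E2 : lc (xpow q (b k.+1)) (predC1 i) = iaddp (lc (xpow q (b k.+1)) (Pc i)) p.
    by rewrite (@lcD1 _ _ _ _ i0) /= 1?eq_sym // bi1.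
  have := @colon_square (xpow q (b k.+1)) (Pc i) i i0 (v i) (sb _) ii0 Pii Pi0.
  rewrite bi1 => -[z' mz'|v' h1 h2]; first by rewrite -E1; apply: hv.
  by exists v' => _; split=> z' mz'; [rewrite E2; apply: h1|rewrite bS //; apply: h2].
have {G}[v' Gv] := choice G.
move: hw; rewrite (@lcD1 _ _ _ _ i0) // bi => -[o ho].
set C := lc _ _ in ho.
have CE : C = lc (xpow q (b k)) (predC1 i0) by apply: eq_lc.
have iC : is_ideal C by rewrite CE; apply: is_ideal_lc.
set y := u * mp q (fun i => (k.+1 <= i)%N : nat).
have yE : y * p = w + \sum_(i : 'I_d | (i < k)%N) v i.
  rewrite -uE /y -mulrA; congr (_ * _).
  have -> : (fun i : 'I_d => (k <= i)%N : nat) = upd (fun i : 'I_d => (k.+1 <= i)%N : nat) i0 1%N.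
    apply/funext => j; rewrite /upd; case: eqP => [->|ji]; first by rewrite /= leqnn.
    by rewrite (leq_eqVlt k); case: eqP => // kj; case: ji; apply: val_inj.
  rewrite mp_upd expr1; congr (mp q _ * _); apply/funext => j; rewrite /upd.
  by case: eqP => // ->; rewrite /= ltnn.
(* What remains of [y] is multiplied by p^2 into the ideal of the other elements; the colon property
   makes it the new summand, of index [i0]. *)
pose y' := y - \sum_(i : 'I_d | (i < k)%N) v' i - o * p.
have hy' z' : m z' -> lc (xpow q (b k)) (predC1 i0) (y' * z').
  have nP : ~~ predC1 i0 i0 by rewrite /= eqxx.
  move=> mz'; apply: (CP (sb k) nP) => //.
  rewrite bi -CE.
  have -> : y' * p ^+ 2 = (w - o * p ^+ 2) * p + \sum_(i : 'I_d | (i < k)%N) (v i - p * v' i) * p.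
    rewrite -mulr_suml sumrB -mulr_sumr.
    have -> : y' * p ^+ 2 = (y * p - p * \sum_(i : 'I_d | (i < k)%N) v' i - o * p ^+ 2) * p.
      by rewrite /y'; ring.
    by rewrite yE; ring.
  apply: idlD => //; first exact: idlMr.
  apply: idl_sum => // i ik; have [_ /(_ p)] := Gv i ik.
  rewrite CE => h; have mp' : m p by case: sq => _; apply.
  by have := h mp'; apply: lcS => j /= /andP[].
exists (o * p), (upd v' i0 y'); split.
- by apply: idlMl; [apply: is_ideal_lc|rewrite -bi1; apply: mem_lc].
- move=> i; rewrite /upd ltnS leq_eqVlt; case: (eqVneq i i0) => [-> _ z' mz'|ii0 /=].
    by rewrite -bS /= ?eqxx //; apply: hy'.
  case: eqP => [ik|_ /= ik]; first by case/eqP: ii0; apply: val_inj.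
  by have [] := Gv i ik.
rewrite -/y (bigD1 i0) //= {1}/upd eqxx.
rewrite (eq_bigl (fun i : 'I_d => (i < k)%N)); last first.
  move=> i; rewrite ltnS leq_eqVlt; case: (eqVneq i i0) => [->|ii0]; rewrite ?andbF ?ltnn //= andbT.
  by case: eqP => // ik; case/eqP: ii0; apply: val_inj.
rewrite (eq_bigr v') => [|i ik]; last first.
  by rewrite /upd; case: eqP => // ii0; rewrite ii0 ltnn in ik.
by rewrite /y'; ring.
Qed.

End LimitClosure.

(** * Determinants as maps between quotients by limit closures *)

Section Determinants.
Variable A : comNzRingType.
Hypothesis noeth : noetherian A.
Variable m : set A.
Hypothesis locm : local_ring m.
Let im : is_ideal m := is_ideal_max locm.
Variable d : nat.
Implicit Types (x q t r : 'I_d -> A) (M N : 'M[A]_d).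
Hypothesis CP : forall x, sop m x -> colon_property m x.

Definition expresses M t q := forall i, q i = \sum_j M i j * t j.

Lemma lc_expresses t q : (forall i, lc t xpredT (q i)) -> exists M, expresses M t q.
Proof.
move=> tq; have [a aE] := choice tq.
exists (\matrix_(i, j) a i j) => i; rewrite aE; apply: eq_bigr => j _.
by rewrite mxE.
Qed.

Lemma expresses_mul M N t q r : expresses M t q -> expresses N q r -> expresses (N *m M) t r.
Proof.
move=> qE rE i; rewrite rE.
transitivity (\sum_k \sum_j N i k * M k j * t j).
  by apply: eq_bigr => k _; rewrite qE mulr_sumr; apply: eq_bigr => j _; rewrite mulrA.
by rewrite exchange_big; apply: eq_bigr => j _; rewrite mxE mulr_suml.
Qed.

Lemma expresses_diag (c : 'I_d -> A) t :
  expresses (diag_mx (\row_i c i)) t (fun i => c i * t i).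
Proof.
move=> i; rewrite (bigD1 i) //= !mxE eqxx mulr1n big1 ?addr0 // => j ji.
by rewrite mxE eq_sym (negbTE ji) mulr0n mul0r.
Qed.

Lemma expresses_diagX n k t :
  expresses (diag_mx (\row_i (t i ^+ k))) (xpow t (fun=> n)) (xpow t (fun=> n + k)%N).
Proof.
move=> i; rewrite -(expresses_diag (fun i => t i ^+ k)) /xpow addnC.
by rewrite exprD.
Qed.

Lemma det_diagX t k : \det (diag_mx (\row_i (t i ^+ k))) = mp t (fun=> k).
Proof. by rewrite det_diag; apply: eq_bigr => i _; rewrite mxE. Qed.

Lemma cramer M t q (P : pred 'I_d) j : (forall i, lc q P (\sum_j M i j * t j)) ->
  lc q P (\det M * t j).
Proof.
move=> qM; have iL := is_ideal_lc q P.
have -> : \det M * t j = \sum_k \adj M j k * \sum_l M k l * t l.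
  transitivity (\sum_l (\adj M *m M) j l * t l).
    rewrite mul_adj_mx (bigD1 j) //= mxE eqxx mulr1n big1 ?addr0 // => l lj.
    by rewrite mxE eq_sym (negbTE lj) mulr0n mul0r.
  under eq_bigr do rewrite mxE mulr_suml.
  rewrite exchange_big; apply: eq_bigr => k _; rewrite mulr_sumr.
  by apply: eq_bigr => l _; rewrite mulrA.
by apply: idl_sum => // k _; apply: idlMl.
Qed.

Lemma det_mul_lc M t q u : expresses M t q -> lc t xpredT u -> lc q xpredT (\det M * u).
Proof.
move=> qE; have iL := is_ideal_lc q xpredT.
rewrite mulrC; suff: lc t xpredT `<=` icolp (lc q xpredT) (\det M) by apply.
apply: lc_sub => [|j _]; first exact: is_ideal_colp.
by rewrite /icolp /= mulrC; apply: cramer => i; rewrite -qE; apply: mem_lc.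
Qed.

(* Two matrices expressing q in terms of t differ row by row by a relation of t. *)
Lemma Lam_det_sub M N t q : (forall i, lc t xpredT (q i)) ->
  expresses M t q -> expresses N t q -> Lam q (\det M - \det N).
Proof.
move=> tq qM qN; have iL := is_ideal_Lam q.
pose mat (f : 'I_d -> 'rV[A]_d) : 'M_d := \matrix_(i, j) f i 0 j.
have matE K : mat (fun i => row i K) = K by apply/matrixP => i j; rewrite !mxE.
pose Phi f := expresses (mat f) t q /\ Lam q (\det M - \det (mat f)).
suff [_] : Phi (fun i => row i N) by rewrite matE.
apply: (@upd_all _ _ Phi _ _ (fun i => row i M)); last first.
  by split; rewrite matE // subrr; apply: idl0.
move=> f i [fE fL].
set f' := upd f i _.
have f'E : expresses (mat f') t q.
  move=> k; rewrite /f' /upd; under eq_bigr do rewrite mxE.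
  case: eqP => [->|_]; first by rewrite qN; apply: eq_bigr => j _; rewrite mxE.
  by rewrite fE; apply: eq_bigr => j _; rewrite mxE.
split=> //.
have -> : \det M - \det (mat f') = (\det M - \det (mat f)) + (\det (mat f) - \det (mat f')) by ring.
apply: idlD => //.
pose D : 'M_d := \matrix_(k, j) (if k == i then f i 0 j - N i j else f k 0 j).
have -> : \det (mat f) - \det (mat f') = \det D.
  rewrite (@determinant_multilinear _ _ D (mat f) (mat f') i 1 (-1)).
  - by rewrite mul1r mulN1r.
  - apply/rowP => j; rewrite !mxE /f' /upd eqxx mxE; ring.
  - by apply/matrixP => k j; rewrite !mxE eq_sym (negbTE (neq_lift _ _)).
  - by apply/matrixP => k j; rewrite !mxE /f' /upd eq_sym (negbTE (neq_lift _ _)).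
apply: (@Lam_colon1 _ _ q i).
have iC := is_ideal_lc q (predC1 i).
rewrite mulrC; suff: lc t xpredT `<=` icolp (lc q (predC1 i)) (\det D) by apply.
apply: lc_sub => [|j _]; first exact: is_ideal_colp.
rewrite /icolp /= mulrC; apply: cramer => k.
have [->|ki] := eqVneq k i.
  rewrite (_ : \sum_j _ = 0); first exact: idl0.
  transitivity (\sum_j (f i 0 j * t j - N i j * t j)).
    by apply: eq_bigr => l _; rewrite mxE eqxx mulrBl.
  rewrite sumrB -qN (fE i) -[RHS](subrr (\sum_j f i 0 j * t j)); congr (_ - _).
  by apply: eq_bigr => l _; rewrite mxE.
rewrite (_ : \sum_j _ = q k); first exact: mem_lc.
by rewrite fE; apply: eq_bigr => l _; rewrite !mxE (negbTE ki).
Qed.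

Lemma sop_exists_power t q n : sop m t -> (0 < n)%N -> (forall i, m (q i)) ->
  exists2 k, (0 < k)%N & forall i, lc (xpow t (fun=> n)) xpredT (q i ^+ k).
Proof.
move=> st n0 mq; have [[iL hp] _] := sop_xpow locm (fun=> n0) st.
have [k hk] := choice (fun i => hp (q i) (mq i)).
exists (\sum_i k i).+1 => // i; apply: (idlXn iL _ (hk i)).
by rewrite (bigD1 i) //=; lia.
Qed.

(** For suitable k, both N diag(t) and diag(q^(k-1)) M express q^k through t, where [N] expresses it
    through t^2, so their determinants agree modulo L(q^k). The first sends [u] into (q^k), as u
    t_1...t_d is in (t^2); the factor (q_1...q_d)^(k-1) of the second cancels by [Lam_mul_intro]. *)
Lemma Lam_det_mul M t q u : sop m t -> sop m q -> expresses M t q ->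
  Lam t u -> Lam q (\det M * u).
Proof.
move=> st sq qE tu; have [_ mq] := sq.
have [k k0 tk] := sop_exists_power st (isT : 0 < 2)%N mq.
have [N NE] := lc_expresses (q := xpow q (fun=> k)) tk.
have E1 := expresses_mul (@expresses_diagX 1 1 t) NE.
rewrite xpow1 in E1.
have E2 := expresses_mul qE (_ : expresses (diag_mx (\row_i (q i ^+ k.-1))) q (xpow q (fun=> k))).
have {}E2 : expresses (diag_mx (\row_i (q i ^+ k.-1)) *m M) t (xpow q (fun=> k)).
  apply: E2; have := @expresses_diagX 1 k.-1 q; rewrite xpow1.
  by rewrite (_ : (fun=> 1 + k.-1)%N = (fun=> k)) //; apply/funext => i; lia.
have iLam := is_ideal_Lam (xpow q (fun=> k)).
have tqk i : lc t xpredT (xpow q (fun=> k) i).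
  by rewrite E1; exists (fun j => (N *m diag_mx (\row_i (t i ^+ 1))) i j).
have := Lam_det_sub tqk E1 E2; rewrite !det_mulmx !det_diagX => h.
have h1 : Lam (xpow q (fun=> k)) (\det N * mp t (fun=> 1%N) * u).
  rewrite -mulrA [_ * u]mulrC; apply: lc_Lam; apply: (det_mul_lc NE); exact: tu.
have h2 : Lam (xpow q (fun=> k)) (\det M * u * mp q (fun=> k.-1)).
  have -> : \det M * u * mp q (fun=> k.-1) = \det N * mp t (fun=> 1%N) * u
    - (\det N * mp t (fun=> 1%N) - mp q (fun=> k.-1) * \det M) * u by ring.
  by apply: idlB => //; apply: idlMr.
rewrite -(xpow1 q); apply: (Lam_mul_intro locm CP (a := k.-1)) => //.
by rewrite add1n prednK.
Qed.

(** Expressing some t^k through q gives a map back: modulo L(t^k), det N det M acts as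
    (t_1...t_d)^(k-1), which is injective. *)
Lemma Lam_det_cancel M t q u : sop m t -> sop m q -> expresses M t q ->
  Lam q (\det M * u) -> Lam t u.
Proof.
move=> st sq qE qu; have [_ mt] := st.
have [k k0 tk] := sop_exists_power sq (isT : 0 < 1)%N mt.
rewrite xpow1 in tk.
have [N NE] := lc_expresses (q := xpow t (fun=> k)) tk.
have stk : sop m (xpow t (fun=> k)) := sop_xpow locm (fun=> k0) st.
have := Lam_det_mul sq stk NE qu.
have E1 := expresses_mul qE NE.
have E2 : expresses (diag_mx (\row_i (t i ^+ k.-1))) t (xpow t (fun=> k)).
  have := @expresses_diagX 1 k.-1 t; rewrite xpow1.
  by rewrite (_ : (fun=> 1 + k.-1)%N = (fun=> k)) //; apply/funext => i; lia.
have tqk i : lc t xpredT (xpow t (fun=> k) i).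
  by rewrite E1; exists (fun j => (N *m M) i j).
have := Lam_det_sub tqk E1 E2; rewrite !det_mulmx !det_diagX => h h1.
have iLam := is_ideal_Lam (xpow t (fun=> k)).
rewrite -(xpow1 t); apply: (Lam_mul_intro locm CP (a := k.-1)) => //.
rewrite add1n prednK //.
have -> : u * mp t (fun=> k.-1) = \det N * (\det M * u)
    - (\det N * \det M - mp t (fun=> k.-1)) * u by ring.
by apply: idlB => //; apply: idlMr.
Qed.

(* The socle of A / Lam (t^n) comes from a bounded level: this is the finiteness of the socle of the
   top local cohomology module. *)
Lemma Lam_socle t n u : sop m t -> (d < n)%N ->
  (forall z, m z -> Lam (xpow t (fun=> n)) (u * z)) ->
  exists y, Lam (xpow t (fun=> n)) (u - mp t (fun=> n - d.+1)%N * y).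
Proof.
move=> st dn hu; have [_ mt] := st.
have n0 : (0 < n)%N by lia.
(* Since u t_i is in L(t^n), X t_i is in (t^(n+1)); peeling a factor t_i puts [X] in the ideal
   generated by t_i^n and the t_j^(n+1), j <> i, for every [i]. *)
pose X := u * mp t (fun=> 1%N).
have X1 i : lc (xpow t (upd (fun=> n.+1) i n)) xpredT X.
  have := Lam_elim locm CP st n0 (hu _ (mt i)).
  have -> : u * t i * mp t (fun=> 1%N) = u * mp t (upd (fun=> 1%N) i 0%N) * t i ^+ 2.
    by rewrite -[in LHS](upd_id (fun=> 1%N) i) [in LHS]mp_upd expr1 expr2; ring.
  have -> : X = u * mp t (upd (fun=> 1%N) i 0%N) * t i.
    by rewrite /X -[in LHS](upd_id (fun=> 1%N) i) [in LHS]mp_upd expr1 mulrA.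
  move=> h; have := @peel _ _ locm _ CP t (fun=> n.+1) i n.-1 2 _ st (fun=> isT) isT.
  rewrite prednK //; apply; move: h; congr (lc (xpow t _) _ _).
  by apply/funext => j; rewrite /upd; case: eqP => // _; lia.
pose Pk k : 'I_d -> nat := fun i => if (i < k)%N then n else 0%N.
(* Each step extracts one more factor t_i^n; for k = d the monomial is (t_1...t_d)^n. *)
have claim k : (k <= d)%N -> exists a,
    lc (xpow t (fun=> n.+1 + k)%N) xpredT (X * mp t (fun=> k) - a * mp t (Pk k)).
  elim: k => [_|k IH kd].
    exists X; rewrite (_ : X * _ - _ = 0); first by apply: idl0; apply: is_ideal_lc.
    by rewrite /mp !big1 ?subrr // => i _; rewrite expr0.
  have [a ha] := IH (ltnW kd); pose i0 := Ordinal kd.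
  have iE := is_ideal_lc (xpow t (upd (fun=> n.+1 + k)%N i0 n)) xpredT.
  have ha1 : lc (xpow t (upd (fun=> n.+1 + k)%N i0 n)) xpredT (a * mp t (Pk k)).
    apply: (idlBl (x := X * mp t (fun=> k)) iE).
      move: ha; apply: lc_xpow_le => i _; rewrite /upd; case: eqP => // _; lia.
    have := lc_mul (fun=> k) (X1 i0); apply: lc_xpow_le => i _.
    by rewrite /upd; case: eqP => // _; lia.
  (* For [i < k], [k.+1] is what the factor t_i^n in [mp t (Pk k)] leaves of the exponent
     [n.+1 + k]. *)
  pose nn (i : 'I_d) := if (i < k)%N then k.+1 else if i == i0 then n else (n.+1 + k)%N.
  have nnE i : (nn i + Pk k i)%N = upd (fun=> n.+1 + k)%N i0 n i.
    rewrite /nn /Pk /upd; case: ltnP => ik; case: eqP => ii0; try lia.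
    by move: ik; rewrite ii0 /=; lia.
  have := @monomial_peel _ _ locm _ CP t nn (Pk k) a st.
  rewrite (funext nnE) => h.
  have nn0 i : (0 < nn i + Pk k i)%N.
    by rewrite /nn /Pk; case: ifP => _; last case: ifP; lia.
  have {h}ha2 := h nn0 ha1.
  pose v i : nat := (0 < Pk k i)%N; rewrite -/(v) in ha2.
  move: ha2; rewrite (@lcD1 _ _ _ _ i0) // => -[w hw].
  pose c (i : 'I_d) := if (i < k)%N then n else 1%N.
  have {}hw := lc_mul c hw.
  exists (w * mp t (fun i => (k <= i)%N : nat)).
  have t1 : t i0 ^+ n = mp t (upd (fun=> 0%N) i0 n).
    rewrite mp_upd (upd_id (fun=> 0%N)) /mp big1 ?mul1r // => i _; exact: expr0.
  have e1 : mp t (fun=> k.+1) = mp t (fun=> k) * mp t (fun=> 1%N).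
    by rewrite -mpD; apply: eq_bigr => i _; rewrite addn1.
  have e2 : mp t (Pk k) * mp t (fun=> 1%N) = mp t v * mp t c.
    rewrite -!mpD; apply: eq_bigr => i _; congr (_ ^+ _).
    by rewrite /v /Pk /c; case: ifP => _; rewrite ?n0; lia.
  have e3 : xpow t (fun i => nn i + v i)%N i0 * mp t c =
      mp t (fun i => (k <= i)%N : nat) * mp t (Pk k.+1).
    rewrite /xpow {1}/nn {1}/v {1}/Pk ltnn eqxx addn0 t1 -!mpD.
    apply: eq_bigr => i _; congr (_ ^+ _); rewrite /upd /c /Pk ltnS.
    case: (ltngtP i k) => ik; case: (eqVneq i i0) => [ii0|ii0] /=; try lia.
    - by move: ik; rewrite ii0 /= ltnn.
    - by move: ik; rewrite ii0 /= ltnn.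
    - by case/eqP: ii0; apply: val_inj.
  have -> : X * mp t (fun=> k.+1) - w * mp t (fun i => (k <= i)%N : nat) * mp t (Pk k.+1) =
      (X * mp t (fun=> k) - a * mp t (Pk k)) * mp t (fun=> 1%N) +
      (a * mp t v - w * xpow t (fun i => nn i + v i)%N i0) * mp t c.
    rewrite e1 -[w * mp t _ * _]mulrA -e3 !mulrBl -!mulrA e2; ring.
  have iL := is_ideal_lc (xpow t (fun=> n.+1 + k.+1)%N) xpredT.
  apply: idlD => //.
    have := lc_mul (fun=> 1%N) ha; rewrite (_ : (fun=> n.+1 + k + 1)%N = (fun=> n.+1 + k.+1)%N) //.
    by apply/funext => i; lia.
  move: hw; apply: lc_subset => i /= ii0.
  apply: (idlXn iL (n := (n.+1 + k.+1)%N)); last exact: (mem_lc (xpow t (fun=> n.+1 + k.+1)%N)).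
  rewrite /nn /v /Pk /c; case: ifP => // ik; rewrite ?n0 ?(negbTE ii0); lia.
have [a ha] := claim d (leqnn d); exists a.
apply: (Lam_intro locm CP (a := d.+1)) => //.
have PE : mp t (Pk d) = mp t (fun=> n - d.+1)%N * mp t (fun=> d.+1).
  rewrite -mpD; apply: eq_bigr => i _; congr (_ ^+ _); rewrite /Pk ltn_ord; lia.
have e1 : mp t (fun=> d.+1) = mp t (fun=> 1%N) * mp t (fun=> d).
  by rewrite -mpD; apply: eq_bigr => i _; rewrite add1n.
rewrite mulrBl; move: ha; rewrite PE /X -[u * _ * _]mulrA -e1 mulrA [a * _]mulrC.
congr (lc (xpow t _) _ _); apply/funext => i; lia.
Qed.

(** With M = M' diag(t) expressing q through t^(d+1), [u] is det M y modulo L(q) for some y in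
    L(t^(d+1)) : m. The factor t_1...t_d carries y z into (t^(d+2)) and det M' carries that into Q;
    [Lam_sub_colon] takes care of the difference. *)
Lemma socle_lift t q u : sop m t -> sop m q ->
  (forall i, lc (xpow t (fun=> d.+2)) xpredT (q i)) ->
  (forall z, m z -> Lam q (u * z)) -> forall z, m z -> lc q xpredT (u * z).
Proof.
move=> st sq tq hu z mz; have [_ mt] := st.
have [k k0 qt] := sop_exists_power sq (isT : 0 < 1)%N mt.
rewrite xpow1 in qt; pose n := (k + d.+1)%N.
have n0 : (0 < n)%N by lia.
have {}qt i : lc q xpredT (xpow t (fun=> n) i).
  by apply: (idlXn (is_ideal_lc _ _) _ (qt i)); apply: leq_addr.
have [N NE] := lc_expresses qt.
have stn : sop m (xpow t (fun=> n)) := sop_xpow locm (fun=> n0) st.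
have iLn := is_ideal_Lam (xpow t (fun=> n)); have iLq := is_ideal_Lam q.
have [||y hy] := @Lam_socle t n (\det N * u) st.
- by rewrite /n; lia.
- by move=> z' mz'; rewrite -mulrA; apply: (Lam_det_mul sq stn NE); apply: hu.
have hyz z' : m z' -> Lam (xpow t (fun=> d.+1)) (y * z').
  move=> mz'; apply: (Lam_mul_intro locm CP (a := (n - d.+1)%N)) => //.
  have -> : (fun=> d.+1 + (n - d.+1))%N = (fun=> n)%N :> ('I_d -> nat).
    by apply/funext => i; rewrite subnKC // /n leq_addl.
  have -> : y * z' * mp t (fun=> n - d.+1)%N =
    (\det N * (u * z')) - (\det N * u - mp t (fun=> n - d.+1)%N * y) * z' by ring.
  apply: idlB => //; last exact: idlMr.
  by apply: (Lam_det_mul sq stn NE); apply: hu.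
have [M' ME'] := lc_expresses tq.
have D1 : expresses (diag_mx (\row_i (t i ^+ 1))) (xpow t (fun=> d.+1)) (xpow t (fun=> d.+2)).
  by rewrite -(addn1 d.+1); apply: expresses_diagX.
have ME := expresses_mul D1 ME'.
have E1 := expresses_mul ME NE.
have E2 := @expresses_diagX d.+1 (n - d.+1) t.
rewrite (_ : (fun=> d.+1 + (n - d.+1))%N = (fun=> n)%N) in E2; last first.
  by apply/funext => i; rewrite subnKC // /n leq_addl.
set M := M' *m _ in ME E1.
have tn i : lc (xpow t (fun=> d.+1)) xpredT (xpow t (fun=> n) i).
  by rewrite E1; exists (fun j => (N *m M) i j).
have := Lam_det_sub tn E1 E2; rewrite det_mulmx det_diagX => hd.
have hq : Lam q (u - \det M * y).
  apply: (Lam_det_cancel sq stn NE).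
  have -> : \det N * (u - \det M * y) = (\det N * u - mp t (fun=> n - d.+1)%N * y)
    - (\det N * \det M - mp t (fun=> n - d.+1)%N) * y by ring.
  by apply: idlB => //; apply: idlMr.
have -> : u * z = (u - \det M * y) * z + \det M' * (y * z * mp t (fun=> 1%N)).
  by rewrite /M det_mulmx det_diagX; ring.
apply: idlD; first exact: is_ideal_lc.
  exact: (Lam_sub_colon locm CP sq hq mz).
apply: (det_mul_lc ME'); exact: (Lam_elim locm CP st (ltn0Sn d) (hyz z mz)).
Qed.

End Determinants.

(** * The equality I^2 = QI *)

Section Dimension.
Variable A : comNzRingType.
Hypothesis noeth : noetherian A.
Variable m : set A.
Hypothesis locm : local_ring m.
Let im : is_ideal m := is_ideal_max locm.

(** A positive value is not the default of [chain_sup], so it is attained. *)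
Lemma krull_dim_chain : (0 < krull_dim A)%N -> has_chain (@prime_ideal A) (krull_dim A).
Proof.
rewrite /krull_dim /chain_sup; case: xgetP => [n _ []|] //; by [].
Qed.

Lemma prime_sub_max (P : set A) : prime_ideal P -> P `<=` m.
Proof. by case=> iP nP1 _; apply: (proper_sub_max noeth locm). Qed.

Lemma primeX (P : set A) x n : prime_ideal P -> P (x ^+ n) -> P x.
Proof.
case=> iP nP1 pP; elim: n => [/nP1//|n IH]; rewrite exprS => /pP[]//.
Qed.

Lemma max_not_nil : (0 < krull_dim A)%N -> ~ forall x, m x -> exists n, x ^+ n = 0.
Proof.
move=> d0 nil; have [P [Pp Plt]] := krull_dim_chain d0.
have [P01 nP01] := Plt 0%N d0; apply: nP01 => y Py.
have [n yn] := nil y (prime_sub_max (Pp 1%N d0) Py).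
apply: (primeX (n := n) (Pp 0%N isT)); rewrite yn; apply: idl0; by case: (Pp 0%N isT).
Qed.

Lemma is_ideal0 : is_ideal [set (0 : A)].
Proof.
split=> [//|x y -> ->|a x ->] /=; first by rewrite addr0.
by rewrite mulr0.
Qed.

(** For primes P0 < P1 < P2 and y in P1 outside P0, [principal_ideal_power] modulo P0 puts a power
    of [a] in P0 + (y). Hence P1 contains [a], therefore [m], against P1 < P2. *)
Lemma dim_le1 a : m a -> max_primary m (iaddp [set 0] a) -> (krull_dim A <= 1)%N.
Proof.
move=> ma pa; rewrite leqNgt; apply/negP => d2.
have [P [Pp Plt]] := krull_dim_chain (ltnW d2).
have [iP0 nP01 prP0] := Pp 0%N isT; have [iP1 _ prP1] := Pp 1%N (ltnW d2).
have [P01 nP10] := Plt 0%N (ltnW d2); have [P12 nP21] := Plt 1%N d2.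
have [y P1y nP0y] : exists2 y, P 1%N y & ~ P 0%N y.
  by apply: contrapT => h; apply: nP10 => y Py; apply: contrapT => nPy; apply: h; exists y.
have pP0 : max_primary m (iaddp (P 0%N) a).
  apply: max_primaryS pa; first exact: is_ideal_addp.
  by apply: addpS => _ ->; apply: idl0.
have my : m y := prime_sub_max (Pp 1%N (ltnW d2)) P1y.
have [n [k [b hb]]] := principal_ideal_power noeth locm iP0 ma pP0 my.
have P1a : P 1%N a.
  apply: (primeX (n := k) (Pp 1%N (ltnW d2))).
  have : P 0%N (y ^+ n * (a ^+ k - b * y)).
    by move: hb; congr (P 0%N _); rewrite exprS; ring.
  case/prP0 => [/(primeX (Pp 0%N isT))//|/P01 h].
  by apply: (idlBr iP1 h); apply: idlMl.
apply: nP21; apply: (subset_trans (prime_sub_max (Pp 2%N d2))) => z mz.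
have [_ /(_ z mz)[j hj]] := pP0.
by apply: (primeX (n := j) (Pp 1%N (ltnW d2))); apply: (addp_sub iP1 P01 P1a).
Qed.

Lemma multiplicity1 z : krull_dim A = 1%N -> m z ->
  (forall w, m w -> exists b, forall w', m w' -> (w - b * z) * w' = 0) ->
  multiplicity m = 1.
Proof.
move=> d1 mz hz.
have d0 : (0 < krull_dim A)%N by rewrite d1.
pose P n := iaddp [set 0] (z ^+ n).
have iP n : is_ideal (P n) by apply: is_ideal_addp; apply: is_ideal0.
have inP n b : P n (b * z ^+ n) by exists b; rewrite /= subrr.
have mP n : ideal_exp m n.+2 = P n.+2.
  apply/seteqP; split; last first.
    by move=> u [b /eqP]; rewrite subr_eq0 => /eqP->; exact: (idlMl b (is_ideal_exp n.+2 im) (ideal_expX n.+2 im mz)).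
  elim: n => [|n IH].
    apply: ideal_mul_sub => // w w' mw mw'.
    have [b /(_ _ mw')/eqP] := hz w mw; rewrite mulrBl subr_eq0 => /eqP ->.
    have [b' /(_ _ mz)/eqP] := hz w' mw'; rewrite mulrBl subr_eq0 => /eqP h.
    by rewrite -mulrA [z * w']mulrC h -mulrA -expr2 mulrA; apply: inP.
  rewrite ideal_expS //; apply: ideal_mul_sub => // w w' mw /IH[c /eqP].
  rewrite subr_eq0 => /eqP ->; have [b /(_ _ mz)/eqP] := hz w mw.
  rewrite mulrBl subr_eq0 => /eqP h.
  have -> : w * (c * z ^+ n.+2) = c * b * z ^+ n.+3.
    by rewrite exprS; transitivity (c * (w * z) * z ^+ n.+1); [|rewrite h !exprS]; ring.
  exact: inP.
have pm : max_primary m m by split=> // x mx; exists 1%N.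
have fm n := max_primary_finite noeth locm (max_primary_exp_ideal n pm).
have step n : colength (ideal_exp m n.+3) = (colength (ideal_exp m n.+2)).+1.
  rewrite !mP /P colength_powS //; last 2 first.
  - exact: is_ideal0.
  - by rewrite -/(P n.+3) -mP.
  rewrite -[RHS]addn1; congr addn; rewrite -(colength_max locm); congr colength.
  have i1 := is_ideal_colp (z ^+ n.+2) is_ideal0.
  apply/seteqP; split.
    apply: (proper_sub_max noeth locm); first exact: is_ideal_addp.
    move=> [a]; rewrite /icolp /= => h.
    have zn : z ^+ n.+2 = 0.
      by apply: (colp_unit noeth locm is_ideal0 (x := a * z)) => //; apply: idlMl.
    apply: (max_not_nil d0) => x mx; exists n.+2.
    have : ideal_exp m n.+2 (x ^+ n.+2) by apply: ideal_expX.
    by rewrite mP /P zn => -[b /=]; rewrite mulr0 subr0.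
  move=> w mw; have [b hb] := hz w mw; exists b.
  by rewrite /icolp /= exprS mulrA hb // mul0r.
have colE n : colength (ideal_exp m n.+2) = (n + colength (ideal_exp m 2))%N.
  by elim: n => // n IH; rewrite step IH.
pose p0 : {poly rat} := 'X + ((colength (ideal_exp m 2))%:R - 1)%:P.
have p0E n : (1 <= n)%N -> p0.[n%:R] = (colength (ideal_exp m n.+1))%:R.
  case: n => // n _; rewrite colE hornerD hornerX hornerC natrD -natr1; ring.
have [n1 h1] : exists n1, forall n, (n1 <= n)%N ->
    (hilbert_samuel_poly m).[n%:R] = (colength (ideal_exp m n.+1))%:R.
  apply: (@xgetI _ 0 [set p : {poly rat} | exists n1, forall n, (n1 <= n)%N ->
    p.[n%:R] = (colength (ideal_exp m n.+1))%:R] p0).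
  by exists 1%N.
have -> : multiplicity m = 1`!%:R * (hilbert_samuel_poly m)`_1 by rewrite /multiplicity d1.
have -> : hilbert_samuel_poly m = p0.
  apply: (poly_eq_eventually (n0 := maxn 1 n1)) => n; rewrite geq_max => /andP[n0 n1n].
  by rewrite h1 // p0E.
by rewrite coefD coefX coefC addr0 mulr1.
Qed.

Lemma mem_ideal_mul_lc d (q : 'I_d -> A) u : ideal_mul m (lc q xpredT) u ->
  exists2 b : 'I_d -> A, (forall i, m (b i)) & u = \sum_i b i * q i.
Proof.
suff: ideal_mul m (lc q xpredT) `<=`
    [set u | exists2 b : 'I_d -> A, (forall i, m (b i)) & u = \sum_i b i * q i] by apply.
apply: ideal_mul_sub.
  split=> [|_ _ [a ma ->] [b mb ->]|c _ [a ma ->]].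
  - by exists (fun=> 0) => [i|]; [apply: idl0|rewrite big1 // => i _; rewrite mul0r].
  - exists (fun i => a i + b i) => [i|]; first exact: idlD.
    by rewrite -big_split; apply: eq_bigr => i _; rewrite mulrDl.
  - exists (fun i => c * a i) => [i|]; first exact: idlMl.
    by rewrite mulr_sumr; apply: eq_bigr => i _; rewrite mulrA.
move=> x y mx [a ->]; exists (fun i => x * a i) => [i|]; first exact: idlMr.
by rewrite mulr_sumr; apply: eq_bigr => i _; rewrite mulrA.
Qed.

Lemma mem_lc_mul d (q b : 'I_d -> A) : (forall i, m (b i)) ->
  ideal_mul m (lc q xpredT) (\sum_i b i * q i).
Proof.
move=> mb; apply: idl_sum => [|i _]; first exact: is_ideal_mul.
by apply: ideal_mulP => //; apply: mem_lc.
Qed.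

(** If u z = sum r_j q_j with r_i a unit, then u z may replace q_i in the system. For w in [m], u w
    = b u z modulo q' = (q_j, j <> i), and the colon property of the new system gives (w - b z) m
    inside q'. For d = 1, q' is 0 and [multiplicity1] applies; for d >= 2, q' lies in m^3 and
    [dim_le1] is contradicted. *)
Lemma colon_mul_max d (q : 'I_d -> A) u z : d = krull_dim A -> (0 < d)%N ->
  (2 <= krull_dim A)%N \/ (krull_dim A = 1%N /\ 1 < multiplicity m) ->
  (forall x : 'I_d -> A, sop m x -> colon_property m x) ->
  sop m q -> (forall i, ideal_exp m 3 (q i)) ->
  ideal_colon (lc q xpredT) m u -> m z -> ideal_mul m (lc q xpredT) (u * z).
Proof.
move=> dE d0 dim CP sq q3 hu mz; apply: contrapT => nuz.
have [pq mq] := sq; have [r rE] := hu z mz.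
have [i nri] : exists i, ~ m (r i).
  apply: contrapT => h; apply: nuz; rewrite rE; apply: mem_lc_mul => i.
  by apply: contrapT => nr; apply: h; exists i.
have [s sr] := unit_nmax noeth locm nri.
set q' := lc q (predC1 i); have iq' : is_ideal q' by apply: is_ideal_lc.
have E : lc (upd q i (u * z)) xpredT = lc q xpredT.
  rewrite lc_upd (lc_full q i) -/q'; apply/seteqP; split.
    apply: addp_sub; [exact: is_ideal_addp|exact: sub_addp|].
    by rewrite -lc_full; apply: hu.
  apply: addp_sub; [exact: is_ideal_addp|exact: sub_addp|].
  exists s; rewrite rE (bigD1 i) //= mulrDr mulrA sr mul1r opprD addNKr.
  apply: idlN => //; apply: idlMl => //; apply: idl_sum => // j ji.
  by apply: idlMl => //; apply: mem_lc.
have sx : sop m (upd q i (u * z)).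
  split; first by rewrite E.
  by move=> j; rewrite /upd; case: eqP => // _; apply: (lc_sub im (fun j _ => mq j)); apply: hu.
have key w : m w -> exists b, forall w', m w' -> q' ((w - b * z) * w').
  move=> mw; have := hu w mw; rewrite -E lc_upd -/q' => -[b hb].
  exists b => w' mw'.
  have nP : ~~ predC1 i i by rewrite /= eqxx.
  have := CP _ sx _ i nP (w - b * z) w'; rewrite lc_updN // {1}/upd eqxx -/q'; apply=> //.
  have -> : (w - b * z) * (u * z) = z * (u * w - b * (u * z)) by ring.
  exact: idlMl.
have [d2|[d1 e1]] := dim; last first.
  have q'0 y : q' y -> y = 0.
    move=> [a ->]; apply: big_pred0 => j /=; apply/negP => /negP/eqP; apply.
    have dd : d = 1%N by rewrite dE.
    by apply: ord_inj; have := ltn_ord i; have := ltn_ord j; lia.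
  suff e : multiplicity m = 1 by rewrite e ltxx in e1.
  apply: (multiplicity1 d1 mz) => w /key[b hb]; exists b => w' /hb; exact: q'0.
have q'3 : q' `<=` ideal_exp m 3 by apply: lc_sub => //; apply: is_ideal_exp.
pose J : set A := [set y | exists2 w, m w & y = z * w].
have iJ : is_ideal J.
  split=> [|_ _ [a ma ->] [b mb ->]|c _ [a ma ->]].
  - by exists 0; rewrite ?mulr0 //; apply: idl0.
  - by exists (a + b); rewrite ?mulrDr //; apply: idlD.
  - by exists (c * a); [apply: idlMl|rewrite mulrCA].
have m2J : ideal_exp m 2 `<=` J.
  apply: (nakayama noeth locm (is_ideal_exp 2 im) iJ) => y.
  have iK := is_ideal_add iJ (is_ideal_exp 3 im).
  suff: ideal_exp m 2 `<=` iadd J (ideal_exp m 3) by apply.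
  apply: ideal_mul_sub => // w w' mw mw'; have [b hb] := key w mw.
  exists ((w - b * z) * w'); first by apply: q'3; apply: hb.
  by exists (b * w'); [apply: idlMl|ring].
have := dim_le1 mz; rewrite leqNgt d2 => h; suff: false by []; apply: h.
split; first by apply: is_ideal_addp; apply: is_ideal0.
move=> y my; exists 2; have [w _ ->] : J (y ^+ 2) by apply: m2J; apply: ideal_expX.
by exists w; rewrite /= mulrC subrr.
Qed.

End Dimension.

Theorem mainTheorem8 (A : comNzRingType) (m : set A) :
  buchsbaum m ->
  (2 <= krull_dim A)%N \/ (krull_dim A = 1%N /\ 1 < multiplicity m) ->
  exists l : nat, forall Q : set A,
    parameter_ideal m Q -> Q `<=` ideal_exp m l ->
    ideal_exp (ideal_colon Q m) 2 = ideal_mul Q (ideal_colon Q m).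
Proof.
move=> [noeth locm d0 const] dim; have im := is_ideal_max locm.
pose d := krull_dim A.
have paramP (x : 'I_d -> A) : sop m x -> parameter_ideal m (lc x xpredT).
  move=> /(sopP noeth locm) sx; exists (codom x); rewrite ?ideal_gen_codom //.
  by split; rewrite ?ideal_gen_codom // size_codom card_ord.
have CP (x : 'I_d -> A) : sop m x -> colon_property m x.
  apply: (sop_colon_property noeth locm) => // y z sy sz.
  exact: const (paramP y sy) (paramP z sz).
have param_sop Q : parameter_ideal m Q -> exists2 q : 'I_d -> A, sop m q & Q = lc q xpredT.
  move=> [s [sd rad] ->]; exists (fun i : 'I_d => s`_i); last exact: ideal_gen_nth.
  by apply/(sopP noeth locm); rewrite -ideal_gen_nth.
have [[t st]|nsop] := pselect (exists t : 'I_d -> A, sop m t); last first.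
  (* Without a system of parameters there is no parameter ideal, and any exponent will do. *)
  by exists 0%N => Q /param_sop[q sq]; case: nsop; exists q.
have [pt _] := sop_xpow locm (b := fun=> d.+2) (fun=> isT) st.
have [k hk] := max_primary_exp noeth locm pt.
(* [k] puts Q inside (t_1^(d+2), ..., t_d^(d+2)) for [socle_lift]; 3 serves [colon_mul_max]. *)
exists (maxn k 3) => Q /param_sop[q sq ->] {Q}; set Q := lc q xpredT => Qm.
have iQ : is_ideal Q by apply: is_ideal_lc.
have Q3 : Q `<=` ideal_exp m 3.
  by apply: (subset_trans Qm); apply: ideal_exp_le => //; apply: leq_maxr.
set I := ideal_colon Q m; have iI : is_ideal I by apply: is_ideal_colon.
have QI : Q `<=` I by apply: ideal_colon_sub.
have Im : I `<=` m.
  (* If 1 were in [I], [m] would lie in Q, hence in m^2, and would vanish by Nakayama, against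
     positive dimension. *)
  apply: (proper_sub_max noeth locm) => // I1.
  have mQ : m `<=` Q by move=> x mx; have := I1 x mx; rewrite mul1r.
  apply: (max_not_nil noeth locm d0) => x mx; exists 1%N; rewrite expr1.
  apply: (nakayama noeth locm im (is_ideal0 A) _ mx) => y my; exists y; last by rewrite subrr.
  by apply: (ideal_exp_le (n := 2) im _ (Q3 _ (mQ _ my))).
have mI x z : I x -> m z -> ideal_mul m Q (x * z).
  apply: (colon_mul_max noeth locm (erefl d) d0 dim CP sq) => i.
  by apply: Q3; apply: mem_lc.
have tq i : lc (xpow t (fun=> d.+2)) xpredT (q i).
  by apply: hk; apply: (ideal_exp_le im (leq_maxl k 3)); apply: Qm; apply: mem_lc.
apply/seteqP; split; last exact: ideal_mulS.
apply: ideal_mul_sub => [|x y Ix Iy]; first exact: is_ideal_mul.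
have [a xyE] : Q (x * y) by apply: Ix; apply: Im.
rewrite xyE; apply: idl_sum => [|i _]; first exact: is_ideal_mul.
rewrite mulrC; apply: ideal_mulP; first exact: mem_lc.
apply: (socle_lift locm CP st sq tq) => z mz.
have [b mb yzE] := mem_ideal_mul_lc locm (mI y z Iy mz).
apply: (idlBr (is_ideal_Lam q) (y := x * b i)); last by apply: lc_Lam; apply: Ix.
apply: (@Lam_colon1 _ _ q i).
have sum0 : \sum_j (a j * z - x * b j) * q j = 0.
  transitivity (\sum_j (z * (a j * q j) - x * (b j * q j))).
    by apply: eq_bigr => j _; ring.
  by rewrite sumrB -!mulr_sumr -xyE -yzE; ring.
have -> : (a i * z - x * b i) * q i = - \sum_(j | j != i) (a j * z - x * b j) * q j.
  by apply/eqP; rewrite -addr_eq0; apply/eqP; rewrite -[RHS]sum0 [RHS](bigD1 i).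
have iL := is_ideal_lc q (predC1 i).
apply: idlN => //; apply: idl_sum => // j ji.
by apply: idlMl => //; apply: mem_lc.
Qed.
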